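(* There exists a constant $C > 0$ such that for every positive integer $r$ and every tournament $T$ with $\delta^+(T) \ge C r\sqrt{\log r}$ we have $\mathrm{sm}(T) \ge r$. Moreover, this is tight up to the constant: there exists a constant $c>0$ such that for every sufficiently large integer $r$ there is a tournament $T$ with $\delta^+(T) \ge c r \sqrt{\log r}$ and $\mathrm{sm}(T) < r$.
   Context: All digraphs are finite (with non-empty vertex set) and have no loops and no multiple edges (but both $uv$ and $vu$ may be edges). A tournament is a digraph in which every pair of distinct vertices is joined by exactly one directed edge. $\delta^+(D)$ denotes the minimum out-degree of $D$. A digraph is strongly-connected if for every ordered pair $(u,v)$ of vertices there is a directed path from $u$ to $v$. $\overrightarrow{K}_r$ is the digraph on $r$ vertices in which every pair of distinct vertices is joined by an edge in each direction. A digraph $D'$ is a strong $\overrightarrow{K}_r$ minor if $V(D')$ can be partitioned into $r$ non-empty sets (branch sets), each inducing a strongly-connected subdigraph, such that for any two distinct branch sets there is at least one edge in each direction between them. A digraph contains a strong $\overrightarrow{K}_r$ minor if some subdigraph of it is one. $\mathrm{sm}(D)$ is the largest $r$ such that $D$ contains a strong $\overrightarrow{K}_r$ minor. *)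

(* Defs.v *)
From mathcomp Require Import all_boot.
From mathcomp Require Import boolp.
Set Implicit Arguments.
Unset Strict Implicit.
Unset Printing Implicit Defensive.

(* Vertices are a subset of an ambient finite type, so that subdigraphs are
   again digraphs over the same type. Non-emptiness of the vertex set is not a
   field, so that [induced] is total; it is required in [is_tournament] and in
   [has_strong_minor]. *)
Record digraph (V : finType) := Digraph {
  verts : {set V};
  arcs : {set V * V};
  arcs_verts : arcs \subset setX verts verts;
  arcs_loopless : forall v : V, (v, v) \notin arcs
}.

Section Digraphs.
Variable V : finType.
Implicit Types (D : digraph V) (B : {set V}).

Definition arc D : rel V := fun u v => (u, v) \in arcs D.

Definition is_tournament D : Prop :=
  verts D != set0 /\
  {in verts D &, forall u v, u != v -> arc D u v (+) arc D v u}.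

Definition outdeg D (v : V) : nat := #|[set w | arc D v w]|.

(* Out-degrees are at most #|V|, so the default value is irrelevant when
   [verts D] is non-empty. *)
Definition min_outdeg D : nat :=
  \big[minn/#|V|]_(v in verts D) outdeg D v.

Definition subdigraph D' D : bool :=
  (verts D' \subset verts D) && (arcs D' \subset arcs D).

Lemma induced_arcs_verts D B :
  arcs D :&: setX B B \subset setX (verts D :&: B) (verts D :&: B).
Proof.
apply/subsetP=> -[u v]; rewrite !inE => /and3P[uvD uB vB].
have := subsetP (arcs_verts D) _ uvD.
by rewrite !inE uB vB !andbT.
Qed.

Lemma induced_arcs_loopless D B v : (v, v) \notin arcs D :&: setX B B.
Proof. by rewrite inE negb_and arcs_loopless. Qed.

Definition induced D B : digraph V :=
  Digraph (induced_arcs_verts D B) (@induced_arcs_loopless D B).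

Definition strongly_connected D : Prop :=
  {in verts D &, forall u v, connect (arc D) u v}.

Definition is_strong_minor (r : nat) D : Prop :=
  exists P : {set {set V}},
    [/\ partition P (verts D),
        #|P| = r,
        {in P, forall B, strongly_connected (induced D B)}
      & {in P &, forall B1 B2, B1 != B2 ->
          exists u v, [/\ u \in B1, v \in B2 & arc D u v]}].

Definition has_strong_minor (r : nat) D : Prop :=
  exists D', [/\ verts D' != set0, subdigraph D' D & is_strong_minor r D'].

(* At most #|V| disjoint non-empty branch sets fit in V; see [sm_max]. *)
Definition sm D : nat :=
  \max_(r < #|V|.+1 | `[< has_strong_minor r D >]) r.

Lemma has_strong_minor_leq r D : has_strong_minor r D -> r <= #|V|.
Proof.
case=> D' [_ _ [P [/[dup] partP /and3P[_ _ P0] <- _ _]]].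
apply: leq_trans (max_card (mem (verts D'))).
rewrite (card_partition partP) -sum1_card; apply: leq_sum => B BP.
by rewrite card_gt0; apply: contraNneq P0 => <-.
Qed.

Lemma sm_max r D : has_strong_minor r D -> r <= sm D.
Proof.
move=> rD; have rV := has_strong_minor_leq rD.
apply: (@leq_bigmax_cond _ _ _ (Ordinal (rV : r < #|V|.+1))).
exact/asboolP.
Qed.

Lemma has_strong_minor1 D : verts D != set0 -> has_strong_minor 1 D.
Proof.
case/set0Pn=> x xD.
have aV : set0 \subset setX [set x] [set x] by exact: sub0set.
have a0 v : (v, v) \notin (set0 : {set V * V}) by rewrite inE.
exists (Digraph aV a0); split => /=.
- by apply/set0Pn; exists x; rewrite inE.
- by rewrite /subdigraph /= sub1set xD sub0set.
exists [set [set x]]; split=> /=.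
- rewrite /partition /cover big_set1 eqxx /= trivIset1 inE eq_sym.
  by apply/set0Pn; exists x; rewrite inE.
- by rewrite cards1.
- move=> B; rewrite inE => /eqP-> u v /=.
  by rewrite !inE => /andP[/eqP-> _] /andP[/eqP-> _]; exact: connect0.
- by move=> B1 B2 /set1P-> /set1P->; rewrite eqxx.
Qed.

Lemma has_strong_minor_sm D : verts D != set0 -> has_strong_minor (sm D) D.
Proof.
move=> /has_strong_minor1 D1; have lt1 := has_strong_minor_leq D1.
have P1 : `[< has_strong_minor (Ordinal (lt1 : 1 < #|V|.+1)) D >] by apply/asboolP.
by rewrite /sm (bigmax_eq_arg _ P1); case: arg_maxnP => // i /asboolP.
Qed.

End Digraphs.

(* Main.v *)
Require Import Defs.
From mathcomp Require Import all_boot all_order all_algebra zify ring.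
From mathcomp Require Import reals exp.
Set Implicit Arguments.
Unset Strict Implicit.
Unset Printing Implicit Defensive.
(* From here on [arc] is the arc relation of a digraph, not the arc of a cyclic
   sequence. *)
Import Defs.

(** Both halves rest on one computation: in a random tournament there is no arc
    from one set of t vertices to another with probability 2^(-t^2), so branch
    sets of size about sqrt (log r) are what is needed to make all r^2 pairs of
    branch sets adjacent.

    Upper bound. In a digraph where every vertex sends arcs to a constant
    fraction of a set Q, a typical t-tuple of Q is reached from all but a
    2^(-c) fraction of Q, with c proportional to t. Another random tuple then
    fails to reach it with probability 2^(-ct). Hence r tuples can be chosen
    greedily so that there are arcs between any two of them in both directions
    ([next_tuple]). If the vertices of Q are joined by short walks that survive the
    deletion of few vertices, then each tuple extends to a strongly connected set
    of size O(t), disjoint from the others ([clique_model_dense]).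

    A tournament of minimum out-degree at least 2d is brought to this situation
    by passing to a minimal vertex set W whose out-degrees exceed d by a small
    multiple of the size of W, this excess being capped at d. By minimality, few
    vertices never separate a set from a substantial part of W, so balls grow by a
    constant fraction of d at each step and quickly become large ([large_ball]).
    If W has O(d) vertices, then W is dense and its vertices of substantial
    in-degree form the set Q ([dense_model]). Otherwise take a small set X of
    vertices of out-degree O(d); almost every vertex of W beats almost all of X.
    Short disjoint paths lead from X to such vertices, and contracting them
    yields an almost complete digraph on X, to which the dense case applies
    ([sparse_model]).

    Lower bound. A random tournament with n = Theta(r tau) vertices, where tau is of
    order sqrt (log r), has minimum out-degree at least a tenth of n, up to
    rounding. In any r disjoint vertex sets, at least r / 2 have at most tau
    vertices, so a quadratic number of pairs would each have to be joined by an arc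
    in a prescribed direction; each fails to be with probability at least
    r^(-1/2). All succeed with probability exp (- Omega(r^(3/2))), which beats the
    r^O(n) choices of the sets ([few_minors]). Probabilities are expressed by
    counting 0/1 assignments to pairs of vertices. *)

(** * Counting tools *)

Lemma double_count (S T : finType) (A : {set S}) (B : {set T}) (R : S -> T -> bool) :
  \sum_(x in A) #|[set y in B | R x y]| = \sum_(y in B) #|[set x in A | R x y]|.
Proof.
have sumE (U : finType) (C : {set U}) (P : pred U) :
    #|[set y in C | P y]| = \sum_(y in C) P y.
  rewrite -sum1dep_card big_mkcondr; apply: eq_bigr => y _; by case: (P y).
under eq_bigr do rewrite sumE; under [RHS]eq_bigr do rewrite sumE.
exact: exchange_big.
Qed.

(** Markov's inequality, without division. *)
Lemma markov (T : finType) (A : {set T}) (w : T -> nat) m :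
  m * #|[set x in A | m <= w x]| <= \sum_(x in A) w x.
Proof.
rewrite mulnC -sum_nat_const [leqRHS](big_setID [set x in A | m <= w x]) /=.
have -> : A :&: [set x in A | m <= w x] = [set x in A | m <= w x].
  by apply/setIidPr/subsetP => x; rewrite inE => /andP[].
apply: leq_trans (leq_addr _ _); apply: leq_sum => x; rewrite inE => /andP[_]; exact.
Qed.

Lemma leq_exp_base m n t : m <= n -> m ^ t <= n ^ t.
Proof. by case: t => // t mn; rewrite leq_exp2r. Qed.

Lemma card_bigcup_leq (T I : finType) (F : I -> {set T}) :
  #|\bigcup_i F i| <= \sum_i #|F i|.
Proof.
elim/big_rec2: _ => [|i m A _ IH]; first by rewrite cards0.
by apply: leq_trans (leq_card_setU _ _) _; rewrite leq_add2l.
Qed.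

Lemma card_bigcup_seq (T : finType) (I : eqType) (l : seq I) (F : I -> {set T}) m :
  {in l, forall i, #|F i| <= m} -> #|\bigcup_(i <- l) F i| <= size l * m.
Proof.
elim: l => [_|i l IH Fm]; first by rewrite big_nil cards0.
rewrite big_cons mulSn; apply: leq_trans (leq_card_setU _ _) _.
apply: leq_add; first by apply: Fm; rewrite inE eqxx.
by apply: IH => j jl; apply: Fm; rewrite inE jl orbT.
Qed.

Lemma exists_subset_card (T : finType) (A : {set T}) m :
  m <= #|A| -> exists2 X : {set T}, X \subset A & #|X| = m.
Proof.
case/card_geqP=> s [us <- sA]; exists [set x in s].
  by apply/subsetP => x; rewrite inE => /sA.
by rewrite cardsE; apply/card_uniqP.
Qed.

Lemma bernoulli_expn m n : m ^ n * (m + n) <= m * m.+1 ^ n.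
Proof.
elim: n => [|n IH]; first by rewrite !expn0; lia.
have mn : m ^ n <= m.+1 ^ n by exact: leq_exp_base.
rewrite !expnS; nia.
Qed.

(** The natural-number form of (1 - 1/k)^k <= 1/2. *)
Lemma expn_pred_halves k : 0 < k -> 2 * (k - 1) ^ k <= k ^ k.
Proof.
case: k => // -[|m] _ //; rewrite subn1 /=.
rewrite -(leq_pmul2l (ltn0Sn m)); apply: leq_trans (bernoulli_expn _ _).
by rewrite mulnA mulnC leq_mul2l; apply/orP; right; lia.
Qed.


(** * Tuples chosen greedily *)

Section Greedy.
Variables (V : finType) (e : rel V) (Q : {set V}) (t : nat).
Notation tup := {ffun 'I_t -> V}.
Implicit Types (S : tup) (A : {set V}).

Definition tuples A : {set tup} := [set S : tup | [forall i, S i \in A]].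

Lemma card_tuples A : #|tuples A| = #|A| ^ t.
Proof.
rewrite -[t in RHS]card_ord -card_ffun_on; apply: eq_card => S.
by rewrite inE; apply/forallP/ffun_onP.
Qed.

Lemma tuplesS A (B : {set V}) : A \subset B -> tuples A \subset tuples B.
Proof.
move=> /subsetP AB; apply/subsetP => S; rewrite !inE => /forallP SA.
by apply/forallP => i; apply: AB.
Qed.

(** For a tuple S of vertices of Q, some arc leads from S to S' exactly when S is
    not a tuple of [avoiders S']. *)
Definition avoiders S : {set V} := [set v in Q | [forall i, ~~ e v (S i)]].

(** All but a 2^(-c) fraction of the vertices of Q send an arc into S. *)
Definition absorbing c S := #|avoiders S| * 2 ^ c <= #|Q|.

(** The absorbing tuples that S fails to reach. That S is absorbing bounds the
    tuples that fail to reach S; choosing tuples one at a time also requires the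
    opposite bound. In-degrees are not under control, but double counting shows
    that most tuples have few strangers. *)
Definition strangers c S :=
  [set S' in tuples Q | absorbing c S' && (S \in tuples (avoiders S'))].

Definition sociable c z S := #|strangers c S| * 2 ^ z <= #|Q| ^ t.

(** A random t-tuple is missed by each vertex with probability at most 2^(-2c),
    so it has at most a 2^(-2c) fraction of avoiders on average. *)
Lemma few_nonabsorbing c A : 0 < #|Q| ->
    {in Q, forall v, #|A :\: [set w | e v w]| ^ t * 2 ^ (c + c) <= #|A| ^ t} ->
  #|[set S in tuples A | ~~ absorbing c S]| * 2 ^ c <= #|A| ^ t.
Proof.
move=> q0 spread.
have total : (\sum_(S in tuples A) #|avoiders S|) * 2 ^ (c + c) <= #|Q| * #|A| ^ t.
  rewrite double_count big_distrl /= -sum_nat_const; apply: leq_sum => v vQ.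
  apply: leq_trans (spread v vQ); rewrite leq_mul2r -card_tuples.
  apply/orP; right; apply: subset_leq_card; apply/subsetP => S.
  rewrite !inE => /andP[/forallP SA /forallP Sv]; apply/forallP => i.
  by rewrite !inE Sv SA.
have := markov (tuples A) (fun S => #|avoiders S| * 2 ^ c) #|Q|.
rewrite -big_distrl /= => mk.
rewrite -(leq_pmul2l q0); apply: leq_trans total.
rewrite expnD !mulnA leq_mul2r; apply/orP; right; apply: leq_trans mk.
rewrite leq_mul2l; apply/orP; right; apply: subset_leq_card.
apply/subsetP => S; rewrite !inE => /andP[-> /=].
by rewrite /absorbing -ltnNge => /ltnW.
Qed.

(** The gain from c to c * t in the exponent is what makes tuples of length
    about sqrt (log r) enough: a random tuple falls inside a set of density
    2^(-c) with probability 2^(-c t). *)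
Lemma absorbing_avoider_tuples c S : absorbing c S ->
  #|tuples (avoiders S)| * 2 ^ (c * t) <= #|Q| ^ t.
Proof. by move=> Ss; rewrite card_tuples expnM -expnMn leq_exp_base. Qed.

Lemma sum_strangers c :
  (\sum_(S in tuples Q) #|strangers c S|) * 2 ^ (c * t) <= #|Q| ^ t * #|Q| ^ t.
Proof.
have -> : \sum_(S in tuples Q) #|strangers c S| =
    \sum_(S in tuples Q)
      #|[set S' in tuples Q | absorbing c S' && (S \in tuples (avoiders S'))]| by [].
rewrite double_count big_distrl /= -{1}card_tuples -sum_nat_const.
apply: leq_sum => S' _; have [sh|_] := boolP (absorbing c S').
  apply: leq_trans (absorbing_avoider_tuples sh); rewrite leq_mul2r /=.
  by apply/orP; right; apply: subset_leq_card; apply/subsetP => S; rewrite !inE => /andP[].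
rewrite (_ : [set x in _ | _] = set0) ?cards0 //.
by apply/setP => S; rewrite !inE andbF.
Qed.

Lemma few_unsociable c z : 0 < #|Q| -> c * t = z + z ->
  #|[set S in tuples Q | ~~ sociable c z S]| * 2 ^ z <= #|Q| ^ t.
Proof.
move=> q0 ctz.
have := sum_strangers c; rewrite ctz expnD mulnA => total.
have := markov (tuples Q) (fun S => #|strangers c S| * 2 ^ z) (#|Q| ^ t).
rewrite -big_distrl /= => mk.
have Qt0 : 0 < #|Q| ^ t by rewrite expn_gt0 q0.
rewrite -(leq_pmul2l Qt0); apply: leq_trans total.
rewrite mulnA leq_mul2r; apply/orP; right; apply: leq_trans mk.
rewrite leq_mul2l; apply/orP; right; apply: subset_leq_card.
apply/subsetP => S; rewrite !inE => /andP[-> /=].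
by rewrite /sociable -ltnNge => /ltnW.
Qed.

Definition good c z S := [&& S \in tuples Q, absorbing c S & sociable c z S].

(** The greedy step: among the tuples of an unused part A, holding at least half
    of Q, those that are not good or that clash with one of the fewer than r
    tuples already chosen do not exhaust all tuples. Passing from Q to A costs a
    factor 2^t, which is negligible against 2^z. *)
Lemma next_tuple c z r A (l : seq tup) :
    A \subset Q -> 0 < #|A| -> #|Q| <= 2 * #|A| ->
    0 < c -> c * t = z + z -> r * 2 ^ (t + 2) <= 2 ^ z ->
    {in Q, forall v, #|A :\: [set w | e v w]| ^ t * 2 ^ (c + c) <= #|A| ^ t} ->
    size l < r -> {in l, forall S, good c z S} ->
  exists S, [/\ S \in tuples A, good c z S,
    {in l, forall S', S \notin tuples (avoiders S')} &
    {in l, forall S', S' \notin tuples (avoiders S)}].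
Proof.
move=> AQ A0 Q2A c0 ctz rz spread lr lgood.
have q0 : 0 < #|Q| by apply: leq_trans A0 (subset_leq_card AQ).
have QA : #|Q| ^ t <= 2 ^ t * #|A| ^ t by rewrite -expnMn leq_exp_base.
pose D := [set S in tuples A | ~~ absorbing c S].
pose E := [set S in tuples Q | ~~ sociable c z S].
pose F1 := \bigcup_(S' <- l) tuples (avoiders S').
pose F2 := \bigcup_(S' <- l) strangers c S'.
have hD : #|D| * 2 ^ c <= #|A| ^ t by exact: few_nonabsorbing.
have hE : #|E| * 2 ^ z <= #|Q| ^ t by exact: few_unsociable.
(* A common bound for each of the 2 r - 1 sets of tuples that come from Q and
   not from A. *)
pose m := (#|Q| ^ t) %/ 2 ^ z.
have z0 : 0 < 2 ^ z by rewrite expn_gt0.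
have h1 : #|F1| <= size l * m.
  apply: card_bigcup_seq => S /lgood /and3P[_ sh _].
  rewrite leq_divRL //; apply: leq_trans (absorbing_avoider_tuples sh).
  by rewrite leq_mul2l ctz leq_exp2l // leq_addr orbT.
have h2 : #|F2| <= size l * m.
  by apply: card_bigcup_seq => S /lgood /and3P[_ _]; rewrite leq_divRL.
have hm : m * 2 ^ z <= 2 ^ t * #|A| ^ t by apply: leq_trans (leq_trunc_div _ _) QA.
have At0 : 0 < #|A| ^ t by rewrite expn_gt0 A0.
have : #|D :|: E :|: F1 :|: F2| < #|tuples A|.
  have hE' : #|E| <= m by rewrite leq_divRL.
  apply: leq_ltn_trans (leq_card_setU _ _) _.
  apply: leq_ltn_trans (leq_add (leq_card_setU _ _) h2) _.
  apply: leq_ltn_trans (leq_add (leq_add (leq_card_setU _ _) h1) (leqnn _)) _.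
  apply: leq_ltn_trans (leq_add (leq_add (leq_add (leqnn _) hE') (leqnn _)) (leqnn _)) _.
  rewrite card_tuples.
  have hD2 : 2 * #|D| <= #|A| ^ t.
    by apply: leq_trans hD; rewrite mulnC leq_mul2l -{1}(expn1 2) leq_exp2l // c0 orbT.
  have hm2 : 4 * (r * m) <= #|A| ^ t.
    have t0 : 0 < 2 ^ t by rewrite expn_gt0.
    rewrite -(leq_pmul2l t0); apply: leq_trans hm.
    have -> : 2 ^ t * (4 * (r * m)) = m * (r * 2 ^ (t + 2)) by rewrite expnD; nia.
    by rewrite leq_mul2l rz orbT.
  nia.
move=> lt; have /subsetPn[S SA] : ~~ (tuples A \subset D :|: E :|: F1 :|: F2).
  by apply: contraL lt => /subset_leq_card; rewrite -leqNgt.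
rewrite !in_setU !negb_or -!andbA => /and4P[nD nE nF1 nF2].
have SQ : S \in tuples Q by apply: subsetP SA; exact: tuplesS.
have sh : absorbing c S by move: nD; rewrite inE SA negbK.
have ex : sociable c z S by move: nE; rewrite inE SQ negbK.
exists S; split=> //; first by rewrite /good SQ sh.
- move=> S' lS'; apply: contra nF1 => SS'.
  by rewrite /F1 (big_rem S') //= in_setU SS'.
- move=> S' lS'; apply: contra nF2 => SS'.
  rewrite /F2 (big_rem S') //= in_setU; apply/orP; left.
  by rewrite in_set SQ sh SS'.
Qed.
End Greedy.

(** * Dense digraphs have large clique models *)

Section Walks.
Variables (V : finType) (e : rel V).
Implicit Types (A B : {set V}) (p : seq V).

Definition walk A u p v := [/\ path e u p, {subset p <= A} & last u p = v].

Lemma walk_cat A u p v q w : walk A u p v -> walk A v q w -> walk A u (p ++ q) w.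
Proof.
move=> [up pA <-] [vq qA <-]; split; rewrite ?cat_path ?last_cat ?up //.
by move=> x; rewrite mem_cat => /orP[/pA|/qA].
Qed.

Lemma walkS A B u p v : A \subset B -> walk A u p v -> walk B u p v.
Proof. by move=> /subsetP AB [up pA uv]; split=> // x /pA/AB. Qed.

(** Walks are required to be non-empty so that a one-vertex set is strong only
    if it carries a loop: when vertices stand for contracted paths, a single path
    need not be strongly connected. *)
Definition strong B :=
  {in B &, forall u v, exists p, p != [::] /\ walk B u p v}.

Definition arcs_to A B := [exists u in A, exists v in B, e u v].

Definition mutual : rel {set V} :=
  fun A B => [&& [disjoint A & B], arcs_to A B & arcs_to B A].

Lemma mutual_sym : symmetric mutual.
Proof. by move=> A B; rewrite /mutual disjoint_sym [arcs_to A B && _]andbC. Qed.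

(** Branch sets of a strong complete minor, listed without repetition. *)
Definition clique_model (l : seq {set V}) :=
  [/\ {in l, forall B, B != set0}, {in l, forall B, strong B} &
      pairwise mutual l].

(** Any two vertices are joined by the end of a closed walk through the first,
    which leads to h, followed by the beginning of one through the second. *)
Lemma strong_hub B h : h \in B ->
    {in B, forall b, exists c, [/\ walk B h c h & b \in c]} -> strong B.
Proof.
move=> hB loops u v uB vB.
have [c [[hc cB ch] uc]] := loops u uB; have [c' [[hc' c'B c'h] vc']] := loops v vB.
case/splitPr: uc hc cB ch => c1 c2; rewrite cat_path last_cat /= => /and3P[_ _ uc2] cB ch.
case/splitPr: vc' hc' c'B c'h => d1 d2; rewrite cat_path last_cat /= => /and3P[hd1 dv _] c'B _.
exists (c2 ++ rcons d1 v); split; first by case: (c2); case: (d1).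
split; first by rewrite cat_path uc2 ch rcons_path hd1.
- move=> x; rewrite mem_cat mem_rcons inE => /or3P[xc2|/eqP->//|xd1].
    by apply: cB; rewrite mem_cat inE xc2 !orbT.
  by apply: c'B; rewrite mem_cat xd1.
- by rewrite last_cat last_rcons.
Qed.
End Walks.

(** If a random vertex is missed with probability at most 1 - 1/k, then a random
    tuple of 8kh vertices is missed with probability at most 2^(-8h). *)
Lemma expn_spread k h x y : 0 < k -> k * x <= (k - 1) * y ->
  x ^ (8 * k * h) * 2 ^ (4 * h + 4 * h) <= y ^ (8 * k * h).
Proof.
move=> k0 kxy; set t := 8 * k * h.
have kt : 0 < k ^ t by rewrite expn_gt0 k0.
rewrite -(leq_pmul2l kt).
have h1 : (k * x) ^ t <= ((k - 1) * y) ^ t by exact: leq_exp_base.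
have h2 : 2 ^ (4 * h + 4 * h) * (k - 1) ^ t <= k ^ t.
  rewrite (_ : t = k * (8 * h)); last by rewrite /t; lia.
  rewrite (_ : 4 * h + 4 * h = 8 * h); last by lia.
  by rewrite [(k - 1) ^ _]expnM [k ^ _]expnM -expnMn; apply: leq_exp_base; exact: expn_pred_halves.
rewrite !expnMn in h1.
rewrite mulnA; apply: leq_trans (_ : (k - 1) ^ t * y ^ t * 2 ^ (4 * h + 4 * h) <= _).
  by rewrite leq_mul2r h1 orbT.
by rewrite mulnAC leq_mul2r mulnC h2 orbT.
Qed.

Section Dense.
Variables (V : finType) (e : rel V) (Q : {set V}) (t f L : nat).
Hypothesis short_walks : forall F : {set V}, #|F| <= f ->
  {in Q :\: F &, forall u v, exists p,
     [/\ p != [::], size p <= L & walk e (~: F) u p v]}.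

Lemma closed_walk (F : {set V}) u v : #|F| <= f -> u \in Q :\: F -> v \in Q :\: F ->
  exists c, [/\ walk e (~: F) u c u, v \in c & size c <= 2 * L].
Proof.
move=> Ff uQ vQ; have [p [p0 pL up]] := short_walks Ff uQ vQ.
have [q [q0 qL vq]] := short_walks Ff vQ uQ.
exists (p ++ q); split; first exact: walk_cat up vq.
- case: up => _ _ <-; rewrite mem_cat; apply/orP; left.
  by case: (p) p0 => //= x s _; exact: mem_last.
- by rewrite size_cat mul2n -addnn leq_add.
Qed.

(** The first vertex of the tuple serves as a hub, joined to each other vertex
    of the tuple by a short closed walk. *)
Lemma branch_set (F : {set V}) (S : {ffun 'I_t -> V}) : 0 < t ->
    #|F| <= f -> S \in tuples t (Q :\: F) ->
  exists B : {set V}, [/\ strong e B, forall i, S i \in B, [disjoint B & F] &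
    #|B| <= 2 * L * t].
Proof.
case: t S => // t' S _ Ff; rewrite inE => /forallP SQ.
pose h := S ord0.
have /fin_all_exists[c cP] i := closed_walk Ff (SQ ord0) (SQ i).
pose B := \bigcup_i [set x in c i].
have cB i : {subset c i <= B}.
  by move=> x xc; apply/bigcupP; exists i => //; rewrite inE.
have wB i : walk e B h (c i) h by have [[hc _ ch] _ _] := cP i; split.
exists B; split.
- apply: (@strong_hub _ _ _ h); first by apply: (cB ord0); have [_ h0 _] := cP ord0.
  by move=> b /bigcupP[i _]; rewrite inE => bc; exists (c i).
- by move=> i; apply: (cB i); have [_ h0 _] := cP i.
- rewrite disjoint_subset; apply/subsetP => x /bigcupP[i _]; rewrite inE => xc.
  by have [[_ /(_ _ xc) + _] _ _] := cP i; rewrite !inE.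
- rewrite mulnC -[X in X * _]card_ord -sum_nat_const.
  apply: leq_trans (card_bigcup_leq _) _; apply: leq_sum => i _.
  by have [_ _ s] := cP i; apply: leq_trans s; rewrite cardsE card_size.
Qed.

Variables (k h : nat).
Hypothesis spread : forall A : {set V}, A \subset Q -> #|Q :\: A| <= f ->
  {in Q, forall v, k * #|A :\: [set w | e v w]| <= (k - 1) * #|A|}.

(** With t = 8kh and c = 4h the exponent z = ct/2 = 16kh^2 exceeds the sum of
    h^2 (for the number of tuples) and t (for the loss of half of Q). The branch
    sets together cover at most f vertices, so short walks that avoid all earlier
    branch sets exist throughout. *)
Lemma clique_model_dense r :
    t = 8 * k * h -> 0 < k -> 0 < h -> r <= 2 ^ (h * h) -> 0 < #|Q| ->
    2 * f <= #|Q| -> r * (2 * L * t) <= f ->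
  exists2 l, size l = r & clique_model e l.
Proof.
move=> tE k0 h0 rh q0 fQ rf.
have t0 : 0 < t by rewrite tE !muln_gt0 k0 h0.
pose z := 16 * k * h * h.
pose ok (l : seq ({ffun 'I_t -> V} * {set V})) := [/\
  {in l, forall x : {ffun 'I_t -> V} * {set V},
    good e Q (4 * h) z x.1 /\ (forall i, x.1 i \in x.2)},
  {in l, forall x : {ffun 'I_t -> V} * {set V}, strong e x.2 /\ #|x.2| <= 2 * L * t} &
  pairwise (fun x y : {ffun 'I_t -> V} * {set V} => [&& [disjoint x.2 & y.2],
     x.1 \notin tuples t (avoiders e Q y.1) & y.1 \notin tuples t (avoiders e Q x.1)]) l].
have ext j : j <= r -> exists2 l, size l = j & ok l.
  elim: j => [|j IH jr]; first by exists [::].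
  have [l sl [lg lB lp]] := IH (ltnW jr).
  pose F := \bigcup_(x <- l) x.2.
  have Ff : #|F| <= f.
    apply: leq_trans (card_bigcup_seq (m := 2 * L * t) _) _.
      by move=> x /lB[].
    by apply: leq_trans rf; rewrite sl leq_mul2r ltnW ?orbT.
  have QFf : #|Q :\: (Q :\: F)| <= f.
    by apply: leq_trans Ff; apply: subset_leq_card; rewrite setDDr setDv set0U subsetIr.
  have QF := cardsID (Q :\: F) Q; rewrite (setIidPr (subsetDl Q F)) in QF.
  have lg1 : {in map fst l, forall S, good e Q (4 * h) z S}.
    by move=> S /mapP[x /lg[? _] ->].
  have QF0 : 0 < #|Q :\: F| by lia.
  have Q2 : #|Q| <= 2 * #|Q :\: F| by lia.
  have h40 : 0 < 4 * h by lia.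
  have tz : 4 * h * t = z + z by rewrite tE /z; lia.
  have rz : r * 2 ^ (t + 2) <= 2 ^ z.
    by apply: leq_trans (leq_mul rh (leqnn _)) _; rewrite -expnD leq_exp2l // tE /z; nia.
  have sp : {in Q, forall v, #|(Q :\: F) :\: [set w | e v w]| ^ t * 2 ^ (4 * h + 4 * h)
                             <= #|Q :\: F| ^ t}.
    by move=> v vQ; rewrite tE; apply: expn_spread => //; apply: spread => //; exact: subsetDl.
  have slr : size (map fst l) < r by rewrite size_map sl.
  have [S [SA Sg S1 S2]] := next_tuple (subsetDl Q F) QF0 Q2 h40 tz rz sp slr lg1.
  have [B [Bs SB BF Bc]] := branch_set t0 Ff SA.
  exists ((S, B) :: l); first by rewrite /= sl.
  split; rewrite /= ?lp ?andbT.
  - by move=> x; rewrite inE => /orP[/eqP->|/lg].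
  - by move=> x; rewrite inE => /orP[/eqP->|/lB].
  - apply/allP => x xl /=; rewrite S1 ?S2 ?map_f // !andbT.
    apply: disjointWr BF; by rewrite /F (big_rem _ xl) subsetUl.
have [l sl [lg lB lp]] := ext r (leqnn r).
exists (map snd l); first by rewrite size_map.
have i0 : 'I_t by exact: Ordinal t0.
split.
- move=> B /mapP[x xl ->]; have [_ Sx] := lg x xl.
  by apply/set0Pn; exists (x.1 i0).
- by move=> B /mapP[x /lB[]] ? _ ->.
- rewrite pairwise_map; apply: (sub_in_pairwise (P := mem l)) (allss l) lp.
  move=> x y xl yl /and3P[dxy xy yx] /=; rewrite /mutual dxy /=.
  have arcsI a b : a \in l -> b \in l ->
      a.1 \notin tuples t (avoiders e Q b.1) -> arcs_to e a.2 b.2.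
    move=> al bl; rewrite inE negb_forall => /existsP[i].
    have [/and3P[+ _ _] Sa] := lg a al; rewrite inE => /forallP/(_ i) aiQ.
    have [_ Sb] := lg b bl.
    rewrite inE aiQ /= negb_forall => /existsP[j eij].
    apply/exists_inP; exists (a.1 i) => //; apply/exists_inP; exists (b.1 j) => //.
    by rewrite negbK in eij.
  by rewrite !arcsI.
Qed.
End Dense.

(** * From clique models to strong minors *)

Lemma pairwise_sym_mem (T : eqType) (R : rel T) (s : seq T) :
  symmetric R -> pairwise R s -> {in s &, forall x y, x != y -> R x y}.
Proof.
move=> symR; elim: s => //= z s IH /andP[/allP zs sP] x y.
rewrite !inE => /predU1P[->|xs] /predU1P[->|ys]; rewrite ?eqxx // => xy.
- exact: zs.
- by rewrite symR; exact: zs.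
- exact: IH.
Qed.

Section Model.
Variables (V : finType).
Implicit Types (l : seq {set V}).

Lemma strong_self (e : rel V) (B : {set V}) v : strong e B -> v \in B -> exists u, e u v.
Proof.
move=> sB vB; have [p [p0 [vp _ pv]]] := sB v v vB vB.
case/lastP: p p0 vp pv => // p z _; rewrite rcons_path last_rcons => /andP[_ uz] <-.
by exists (last v p).
Qed.

Lemma walk_connect (e e' : rel V) (A : {set V}) u p v : {in A &, forall x y, e x y -> e' x y} ->
  u \in A -> walk e A u p v -> connect e' u v.
Proof.
move=> ee' uA [up pA uv]; apply/connectP; exists p => //.
elim: p u uA up pA {uv} => //= z p IH u uA /andP[uz zp] pA.
have zA : z \in A by apply: pA; rewrite inE eqxx.
by rewrite ee' //= IH // => x xp; apply: pA; rewrite inE xp orbT.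
Qed.

(** A strong set consists of heads of arcs, hence of vertices of T, and the
    induced subdigraph on the union of the sets is the required one. *)
Lemma has_strong_minor_model (T : digraph V) l :
  l != [::] -> clique_model (arc T) l -> has_strong_minor (size l) T.
Proof.
move=> l0 [lne lst lp].
have apart := pairwise_sym_mem (@mutual_sym V (arc T)) lp.
have arcT u v : arc T u v -> u \in verts T /\ v \in verts T.
  by move=> /(subsetP (arcs_verts T)); rewrite inE => /andP.
have lT B v : B \in l -> v \in B -> v \in verts T.
  by move=> /lst sB vB; have [u /arcT[]] := strong_self sB vB.
pose P := [set B in l].
have coverT : cover P \subset verts T.
  by apply/bigcupsP => B; rewrite inE => Bl; apply/subsetP => v; exact: lT.
have VD : verts (induced T (cover P)) = cover P by exact/setIidPr.
have inP B v : B \in l -> v \in B -> v \in cover P.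
  by move=> Bl vB; apply/bigcupP; exists B; rewrite ?inE.
exists (induced T (cover P)); split.
- rewrite VD; case: l l0 lne P {lst lp apart lT coverT VD} inP => // B l _ lne P inP.
  have /set0Pn[v vB] := lne B (mem_head _ _).
  by apply/set0Pn; exists v; apply: inP vB; rewrite mem_head.
- by rewrite /subdigraph VD coverT /= subsetIl.
exists P; split.
- rewrite VD; apply/and3P; split => //.
    apply/trivIsetP => B B'; rewrite !inE => Bl B'l BB'.
    by have /and3P[] := apart B B' Bl B'l BB'.
  by rewrite inE; apply: contraT; rewrite negbK => /lne; rewrite eqxx.
- have ul : uniq l.
    rewrite uniq_pairwise; apply: (sub_in_pairwise (P := mem l)) (allss l) lp.
    move=> B B' Bl B'l /= /and3P[+ _ _]; apply: contraTneq => <-.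
    have /set0Pn[v vB] := lne B Bl.
    by apply/pred0Pn; exists v; rewrite /= vB.
  by rewrite cardsE; exact/card_uniqP.
- move=> B; rewrite inE => Bl u v; rewrite !inE => /andP[_ uB] /andP[_ vB].
  have [p [_ uv]] := lst B Bl u v uB vB.
  apply: walk_connect uB uv => x y xB yB; rewrite /arc !inE /= => ->.
  by rewrite xB yB (inP B) ?(inP B).
- move=> B B'; rewrite !inE => Bl B'l BB'.
  have /and3P[_ /exists_inP[u uB /exists_inP[v vB' uv]] _] := apart B B' Bl B'l BB'.
  exists u, v; split=> //; rewrite /arc !inE /= (inP B) // (inP B') // !andbT.
  exact: uv.
Qed.
End Model.

(** Disjoint paths from the vertices of X are contracted to their starting
    points; x is then joined to y when the end of the path of x sends an arc to
    y. Traversing each path from start to end turns walks between starting points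
    into walks of the original digraph. *)
Section Contract.
Variables (V : finType) (e : rel V) (X : {set V}) (P : V -> seq V).
Hypothesis Ppath : {in X, forall x, path e x (P x)}.
Hypothesis Pdisj : {in X &, forall x y, x != y ->
  [disjoint [set z in x :: P x] & [set z in y :: P y]]}.

Definition contracted : rel V :=
  fun x y => [&& x \in X, y \in X & e (last x (P x)) y].

Definition expand (B : {set V}) := \bigcup_(x in B) [set z in x :: P x].

Let tip x := last x (P x).

Lemma expandP (B : {set V}) x z : x \in B -> z \in x :: P x -> z \in expand B.
Proof. by move=> xB zx; apply/bigcupP; exists x; rewrite // inE. Qed.

Lemma expand_walk (B : {set V}) x p y : walk contracted B x p y ->
  exists q, walk e (expand B) (tip x) q (tip y).
Proof.
elim: p x => [|z p IH] x [xp pB xy].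
  by exists [::]; split=> //; rewrite -xy.
move: xp => /= /andP[/and3P[xX zX xz] zp].
have [|q zq] := IH z.
  by split=> // w wp; apply: pB; rewrite inE wp orbT.
exists ((z :: P z) ++ q); apply: walk_cat zq; split=> //=.
  by rewrite xz Ppath.
by move=> w; apply: expandP; apply: pB; exact: mem_head.
Qed.

Lemma strong_expand (B : {set V}) : strong contracted B -> strong e (expand B).
Proof.
move=> sB u v /bigcupP[x xB]; rewrite inE => ux /bigcupP[y yB]; rewrite inE => vy.
have BX z : z \in B -> z \in X by move=> /(strong_self sB)[w /and3P[]].
have [s us] : exists s, walk e (expand B) u s (tip x).
  have := Ppath (BX x xB); rewrite /tip; move: (@expandP B x ^~ xB).
  case/splitPl: (P x) / ux => p1 p2 <- subB; rewrite cat_path last_cat => /andP[_ h2].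
  by exists p2; split=> // w wp; apply: subB; rewrite inE mem_cat wp !orbT.
have [s' vs'] : exists s', walk e (expand B) y s' v.
  have := Ppath (BX y yB); move: (@expandP B y ^~ yB).
  case/splitPl: (P y) / vy => p1 p2 <- subB; rewrite cat_path => /andP[h1 _].
  by exists p1; split=> // w wp; apply: subB; rewrite inE mem_cat wp !orbT.
have [p [p0 xy]] := sB x y xB yB.
case/lastP: p p0 xy => // p z _ [+ pB]; rewrite rcons_path last_rcons.
move=> /andP[xp /and3P[_ _ xz]] zy; rewrite {}zy in pB xz.
have [|q xq] := @expand_walk B x p (last x p).
  by split=> // w wp; apply: pB; rewrite mem_rcons inE wp orbT.
have yw : walk e (expand B) (tip (last x p)) [:: y] y.
  split; rewrite //= ?xz // => w; rewrite inE => /eqP->.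
  by apply: (expandP yB); exact: mem_head.
have := walk_cat us (walk_cat xq (walk_cat yw vs')).
by eexists; split; last eassumption; case: (s); case: (q).
Qed.

Lemma clique_model_expand l :
  clique_model contracted l -> clique_model e (map expand l).
Proof.
move=> [lne lst lp].
have lX (B : {set V}) z : B \in l -> z \in B -> z \in X.
  by move=> Bl /(strong_self (lst B Bl))[w /and3P[]].
split.
- move=> _ /mapP[B Bl ->]; have /set0Pn[x xB] := lne B Bl.
  by apply/set0Pn; exists x; apply: (expandP xB); exact: mem_head.
- by move=> _ /mapP[B Bl ->]; apply: strong_expand; exact: lst.
rewrite pairwise_map; apply: (sub_in_pairwise (P := mem l)) (allss l) lp.
move=> A B Al Bl /= /and3P[AB toB toA].
have arcsE A' B' : arcs_to contracted A' B' -> arcs_to e (expand A') (expand B').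
  move=> /exists_inP[x xA' /exists_inP[y yB' /and3P[_ _ xy]]].
  apply/exists_inP; exists (tip x); first by apply: (expandP xA'); exact: mem_last.
  by apply/exists_inP; exists y => //; apply: (expandP yB'); exact: mem_head.
rewrite /mutual !arcsE // !andbT; apply/pred0P => v /=; apply/negbTE/negP.
move=> /andP[/bigcupP[x xA vx] /bigcupP[y yB vy]].
have xy : x != y by apply: contraTneq AB => xy; apply/pred0Pn; exists x; rewrite /= xA xy.
by have /pred0P/(_ v) := Pdisj (lX A x Al xA) (lX B y Bl yB) xy; rewrite /= vx vy.
Qed.
End Contract.

(** * A minimal expanding vertex set *)

Section Core.
Variables (V : finType) (e : rel V).
Implicit Types (A F R : {set V}).

Definition outdeg_in A v := #|[set w in A | e v w]|.
Definition indeg_in A v := #|[set w in A | e w v]|.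

Variables (W : {set V}) (b d L : nat).
Hypothesis W0 : W != set0.
Hypothesis e_irr : irreflexive e.
Hypothesis e_tour : {in W &, forall u v, u != v -> e u v (+) e v u}.

Lemma sum_outdeg_in A : A \subset W ->
  2 * (\sum_(v in A) outdeg_in A v) = #|A| * (#|A| - 1).
Proof.
move=> AW.
have deg v : v \in A -> outdeg_in A v + indeg_in A v = #|A| - 1.
  move=> vA; have vW := subsetP AW v vA.
  have -> : #|A| - 1 = #|A :\ v| by rewrite (cardsD1 v A) vA addKn.
  have -> : outdeg_in A v = #|[set w in A | e v w]| by [].
  rewrite -(cardsID [set w | e v w] (A :\ v)); congr (_ + _); apply: eq_card => w; rewrite !inE.
    by case: eqP => [->|] /=; rewrite ?e_irr ?andbF // andbC.
  case: eqP => [->|/eqP wv] /=; first by rewrite e_irr !andbF.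
  case wA: (w \in A); rewrite ?andbF //= andbT.
  by have := e_tour vW (subsetP AW w wA); rewrite eq_sym => /(_ wv); case: (e v w); case: (e w v).
have io : \sum_(v in A) outdeg_in A v = \sum_(v in A) indeg_in A v.
  exact: double_count.
by rewrite mul2n -addnn {2}io -big_split (eq_bigr _ deg) sum_nat_const.
Qed.

(** The average in-degree inside A is (#|A| - 1) / 2. *)
Lemma few_low_indeg A s : A \subset W -> {in A, forall v, indeg_in W v <= s} ->
  #|A| <= 2 * s + 1.
Proof.
move=> AW low; have := sum_outdeg_in AW.
have -> : \sum_(v in A) outdeg_in A v = \sum_(v in A) indeg_in A v by exact: double_count.
have inle : \sum_(v in A) indeg_in A v <= #|A| * s.
  rewrite -sum_nat_const; apply: leq_sum => v vA; apply: leq_trans (low v vA).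
  apply: subset_leq_card; apply/subsetP => w; rewrite !inE => /andP[wA ->].
  by rewrite (subsetP AW).
nia.
Qed.

(** The minimum out-degree of W exceeds d by a fiftieth of the size of W, this
    excess being capped at d. By minimality of W, a smaller set whose out-degrees
    drop only slightly must be almost as large, as long as the cap is not reached.
    The choice d = 500b made below, with b the number of vertices that may be
    deleted, leaves room for every estimate. *)
Hypothesis Wdeg :
  {in W, forall v, 50 * d + minn #|W| (50 * d) <= 50 * outdeg_in W v}.
Hypothesis Wmin : forall R, R \proper W -> R != set0 ->
  exists2 v, v \in R & 50 * outdeg_in R v < 50 * d + minn #|R| (50 * d).

Definition large R := minn #|W| (50 * d) <= minn #|R| (50 * d) + 100 * b.

(** Out-degrees inside R drop by at most #|F|, which minimality forbids unless R
    is large. *)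
Lemma large_closed R F : R \subset W -> R != set0 -> #|F| <= 2 * b ->
  {in R, forall u, {in W, forall w, e u w -> w \in R :|: F}} -> large R.
Proof.
move=> RW R0 Fb out; rewrite /large.
have [WR|nWR] := boolP (W \subset R).
  by rewrite (_ : R = W) ?leq_addr //; apply/eqP; rewrite eqEsubset RW.
have [|v vR vlow] := Wmin _ R0; first by rewrite properE RW.
have /Wdeg vdeg := subsetP RW v vR.
have : outdeg_in W v <= outdeg_in R v + #|F|.
  apply: leq_trans (leq_card_setU _ _); apply: subset_leq_card; apply/subsetP => w.
  rewrite !inE => /andP[wW vw]; have := out v vR w wW vw.
  by rewrite inE vw andbT.
lia.
Qed.

Hypothesis dL : 50 * d <= L * b.

(** Breadth-first search from u after deletion of F. Unless the ball is already
    large, its next layer has more than b vertices, as otherwise this layer and F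
    would together separate it from the rest of W. So a constant number L of
    steps suffices. *)
Lemma large_ball F u : #|F| <= b -> u \in W :\: F ->
  exists R, [/\ R \subset W :\: F, large R &
    {in R, forall w, exists2 p, size p <= L & walk e (W :\: F) u p w}].
Proof.
move=> Fb uW.
have grow i : exists R, [/\ R \subset W :\: F, R != set0, large R || (i * b <= #|R|) &
    {in R, forall w, exists2 p, size p <= i & walk e (W :\: F) u p w}].
  elim: i => [|i [R [RWF R0 Rbig Rwalk]]].
    exists [set u]; split; rewrite ?sub1set //; first by apply/set0Pn; exists u; rewrite inE.
      by rewrite mul0n orbT.
    by move=> w /set1P->; exists [::].
  have [lR|nlR] := boolP (large R).
    exists R; split; rewrite ?lR // => w /Rwalk[p pi pw]; exists p => //; exact: leqW.
  rewrite (negbTE nlR) /= in Rbig.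
  pose N := [set w in W :\: F | [exists v in R, e v w]].
  exists (R :|: N); split.
  - by rewrite subUset RWF; apply/subsetP => w; rewrite inE => /andP[].
  - by case/set0Pn: R0 => x xR; apply/set0Pn; exists x; rewrite inE xR.
  - apply/orP; right; rewrite leqNgt; apply: contra nlR => small.
    have RN : #|R :|: N| = #|R| + #|N :\: R|.
      by rewrite -(cardsID R (R :|: N)) setDUl setDv set0U (setIidPr (subsetUl R N)).
    apply: (@large_closed R (F :|: (N :\: R))) => //.
    + exact: subset_trans RWF (subsetDl _ _).
    + apply: leq_trans (leq_card_setU _ _) _; lia.
    + move=> v vR w wW vw; rewrite !inE wW !andbT.
      have [//|wR] := boolP (w \in R); have [//|wF] /= := boolP (w \in F).
      by apply/exists_inP; exists v.
  - move=> w; rewrite in_setU => /orP[/Rwalk[p pi pw]|]; first by exists p; rewrite // leqW.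
    rewrite inE => /andP[wWF /exists_inP[v /Rwalk[p pi pv] vw]].
    exists (rcons p w); first by rewrite size_rcons.
    by rewrite -cats1; apply: walk_cat pv _; split; rewrite /= ?vw // => x; rewrite inE => /eqP->.
have [R [RWF _ Rbig Rwalk]] := grow L.
exists R; split=> //; case/orP: Rbig => // Rbig.
rewrite /large; lia.
Qed.

Hypothesis db : d = 500 * b.

(** If #|W| = O(d), then a large ball misses at most 100b vertices of W, hence
    contains an in-neighbour of every vertex of in-degree above 100b. All but at
    most 200b + 1 vertices are of this kind, so each vertex of W sends arcs to a
    constant fraction of them. *)
Lemma dense_model r h : #|W| <= 50 * d -> 0 < b -> 0 < h -> r <= 2 ^ (h * h) ->
    r * (2 * L.+1 * (8 * 100 * h)) <= b ->
  exists2 l, size l = r & clique_model e l.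
Proof.
move=> Wd b0 h0 rh rb.
pose Q := [set v in W | 100 * b < indeg_in W v].
have QW : Q \subset W by apply/subsetP => v; rewrite inE => /andP[].
have WQ : #|W :\: Q| <= 200 * b + 1.
  apply: leq_trans (@few_low_indeg (W :\: Q) (100 * b) (subsetDl _ _) _) _; last by lia.
  by move=> v; rewrite !inE => /andP[vQ vW]; move: vQ; rewrite vW /= -leqNgt.
have deg v : v \in W -> d <= outdeg_in W v by move=> /Wdeg; lia.
have [v0 v0W] := set0Pn _ W0.
have spl := cardsID Q W; rewrite (setIidPr QW) in spl.
have WgeQ : d <= #|W|.
  by apply: leq_trans (deg _ v0W) _; apply: subset_leq_card; apply/subsetP => w; rewrite inE => /andP[].
apply: (@clique_model_dense V e Q (8 * 100 * h) b L.+1 _ 100 h) => //; try lia.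
- move=> F Fb u w; rewrite !inE => /and3P[uF uW _] /and3P[wF wW winW].
  have [|R [RWF Rl Rw]] := @large_ball F u Fb; first by rewrite inE uF.
  have RW : R \subset W := subset_trans RWF (subsetDl _ _).
  have splR := cardsID R W; rewrite (setIidPr RW) in splR.
  have WR : #|W :\: R| <= 100 * b by move: Rl; rewrite /large; lia.
  have /subsetPn[x] : ~~ ([set x in W | e x w] \subset W :\: R).
    by apply: contraL winW => /subset_leq_card le; rewrite -leqNgt; apply: leq_trans le WR.
  rewrite !inE => /andP[xW xw]; rewrite xW andbT negbK => /Rw[p pL px].
  exists (rcons p w); split; rewrite ?size_rcons //; first by case: (p).
  rewrite -cats1; apply: walk_cat (_ : walk e (~: F) x [:: w] w).
    by apply: walkS px; apply/subsetP => y; rewrite !inE => /andP[].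
  by split; rewrite /= ?xw // => y; rewrite !inE => /eqP->.
- move=> A AQ QA x xQ.
  have splA := cardsID [set w | e x w] A.
  have splQ := cardsID A Q; rewrite (setIidPr AQ) in splQ.
  have : outdeg_in W x <= #|A :&: [set w | e x w]| + #|Q :\: A| + #|W :\: Q|.
    apply: leq_trans (leq_add (leq_card_setU _ _) (leqnn _)).
    apply: leq_trans (leq_card_setU _ _); apply: subset_leq_card; apply/subsetP => w.
    rewrite !inE => /andP[wW ->]; rewrite wW andbT.
    by case: (w \in A); case: (_ < _).
  have := deg x (subsetP QW x xQ); lia.
Qed.

(** The requirement on out-degrees never exceeds 2d, so by minimality the set left
    by the deletion of at most d vertices contains a vertex of out-degree below 2d
    in it. One more vertex v0 is deleted to make this set a proper subset. *)
Lemma many_low_outdeg m : 50 * d <= #|W| -> 0 < m -> m <= d ->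
  m <= #|[set v in W | outdeg_in W v <= 3 * d]|.
Proof.
move=> dW m0 md; rewrite leqNgt; apply/negP => few.
set Low := [set v in W | _] in few; have [v0 v0W] := set0Pn _ W0.
have LW : Low \subset W by apply/subsetP => v; rewrite inE => /andP[].
have UW : v0 |: Low \subset W by rewrite subUset sub1set v0W.
have Um : #|v0 |: Low| <= m by rewrite cardsU1; lia.
have spl := cardsID (v0 |: Low) W; rewrite (setIidPr UW) in spl.
have Rp : W :\: (v0 |: Low) \proper W.
  by rewrite properE subsetDl; apply/subsetPn; exists v0; rewrite // !inE eqxx.
have Rne : W :\: (v0 |: Low) != set0 by rewrite -card_gt0; lia.
have [v vR vlow] := Wmin Rp Rne.
have : outdeg_in W v <= outdeg_in (W :\: (v0 |: Low)) v + #|v0 |: Low|.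
  apply: leq_trans (leq_card_setU _ _); apply: subset_leq_card; apply/subsetP => w.
  by rewrite !inE => /andP[-> ->]; rewrite !andbT; case: (w == v0); case: (outdeg_in W w <= 3 * d).
move=> vU; move: vR; rewrite !inE => /andP[+ vW]; rewrite vW /=.
rewrite (_ : outdeg_in W v <= 3 * d) ?orbT //; lia.
Qed.

(** The paths are found one at a time. Each search avoids X and all previous
    paths, and its ball is too large to miss Y. *)
Lemma escape_paths (X Y : {set V}) : X \subset W -> #|X| * L.+2 <= b ->
    #|W :\: Y| < 50 * d - 100 * b -> 50 * d <= #|W| ->
  exists P : V -> seq V,
    {in X, forall x, path e x (P x) /\ last x (P x) \in Y} /\
    {in X &, forall x y, x != y ->
      [disjoint [set z in x :: P x] & [set z in y :: P y]]}.
Proof.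
move=> XW Xb WY dW.
suff [P [Ppath Pavoid Pdisj]] : exists P : V -> seq V,
    [/\ {in enum X, forall x, path e x (P x) /\ last x (P x) \in Y},
        {in enum X, forall x, size (P x) <= L /\ {subset P x <= ~: (X :\ x)}} &
        {in enum X &, forall x y, x != y ->
          [disjoint [set z in x :: P x] & [set z in y :: P y]]}].
  exists P; split; first by move=> x xX; apply: Ppath; rewrite mem_enum.
  by move=> x y xX yX; apply: Pdisj; rewrite mem_enum.
have := enum_uniq X; have : {subset enum X <= X} by move=> x; rewrite mem_enum.
elim: (enum X) => [_ _|x s IH sX /= /andP[xs us]]; first by exists (fun=> [::]).
have [|//|P [Ppath Pavoid Pdisj]] := IH; first by move=> y ys; apply: sX; rewrite inE ys orbT.
have xX : x \in X by apply: sX; exact: mem_head.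
have sX' y : y \in s -> y \in X by move=> ys; apply: sX; rewrite inE ys orbT.
pose F := (X :\ x) :|: \bigcup_(y <- s) [set z in y :: P y].
have inF y z : y \in s -> z \in y :: P y -> z \in F.
  move=> ys zy; rewrite /F (big_rem _ ys) !in_setU; apply/orP; right; apply/orP; left.
  by rewrite inE.
have Fb : #|F| <= b.
  have h1 : #|\bigcup_(y <- s) [set z in y :: P y]| <= size s * L.+1.
    apply: card_bigcup_seq => y ys; have [Ls _] := Pavoid y ys.
    by apply: leq_trans (_ : size (y :: P y) <= _); rewrite ?cardsE ?card_size.
  have h2 : size s <= #|X|.
    rewrite -(card_uniqP us); apply: subset_leq_card; apply/subsetP => y; exact: sX'.
  have h3 := subset_leq_card (subsetDl X [set x]).
  have h4 : size s * L.+1 <= #|X| * L.+1 by rewrite leq_mul2r h2 orbT.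
  by apply: leq_trans (leq_card_setU _ _) _; move: Xb; rewrite mulnS; lia.
have xF : x \notin F.
  rewrite !inE eqxx /=; apply/negP => xb.
  have [y ys] : exists2 y, y \in s & x \in y :: P y.
    elim: (s) xb => [|y s' IHs]; first by rewrite big_nil inE.
    rewrite big_cons in_setU inE => /orP[xy|/IHs[z zs xz]].
      by exists y; rewrite ?mem_head.
    by exists z; rewrite // inE zs orbT.
  rewrite inE => /predU1P[xy|xPy]; first by rewrite xy ys in xs.
  have [_ /(_ x xPy)] := Pavoid y ys; rewrite !inE xX andbT negbK => /eqP xy.
  by rewrite xy ys in xs.
have [|R [RWF Rl Rw]] := @large_ball F x Fb; first by rewrite inE xF (subsetP XW).
have RW : R \subset W := subset_trans RWF (subsetDl _ _).
have /subsetPn[w wR] : ~~ (R \subset W :\: Y).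
  apply/negP => /subset_leq_card le; move: Rl; rewrite /large; lia.
rewrite !inE (subsetP RW) // andbT negbK => wY.
have [p pL [xp pF pw]] := Rw w wR.
pose P' z := if z == x then p else P z.
have P'x : P' x = p by rewrite /P' eqxx.
have P's y : y \in s -> P' y = P y.
  by move=> ys; rewrite /P' ifN //; apply: contraNneq xs => <-.
have apart y : y \in s -> [disjoint [set z in x :: p] & [set z in y :: P y]].
  move=> ys; apply/pred0P => z /=; apply/negbTE/negP; rewrite !inE -in_cons.
  move=> /andP[zp]; rewrite -in_cons => /(inF y z ys) zF.
  case/predU1P: zp => [zx|/pF]; first by rewrite zx (negbTE xF) in zF.
  by rewrite inE zF.
exists P'; split.
- move=> y; rewrite inE => /predU1P[->|ys]; rewrite ?P'x ?P's //; last exact: Ppath.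
  by rewrite pw.
- move=> y; rewrite inE => /predU1P[->|ys]; rewrite ?P'x ?P's //; last exact: Pavoid.
  split=> // z /pF; rewrite !inE => /andP[+ _].
  by apply: contra => ->.
- move=> y z; rewrite !inE => /predU1P[->|ys] /predU1P[->|zs]; rewrite ?eqxx // => yz.
  + by rewrite P'x P's // apart.
  + by rewrite P'x P's // disjoint_sym apart.
  + by rewrite !P's // Pdisj.
Qed.

(** If #|W| >= 50d, let X be a small set of vertices of out-degree at most 3d. Only
    O(d) vertices fail to beat almost all of X, so the remaining set Y contains
    the ends of disjoint paths from X. After contraction of these paths almost
    all ordered pairs of X are arcs. *)
Lemma sparse_model r h : 50 * d <= #|W| -> 0 < r -> 0 < h -> r <= 2 ^ (h * h) ->
    8 * (64 * r * h) * L.+2 <= b ->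
  exists2 l, size l = r & clique_model e l.
Proof.
move=> dW r0 h0 rh rb; set f := 64 * r * h in rb.
have f0 : 0 < f by rewrite /f !muln_gt0 r0 h0.
have mb : 8 * f <= b by apply: leq_trans rb; rewrite leq_pmulr.
have manyLow : 8 * f <= #|[set v in W | outdeg_in W v <= 3 * d]|.
  by apply: many_low_outdeg => //; lia.
have [X XLow Xm] := exists_subset_card manyLow.
have XW : X \subset W by apply: subset_trans XLow _; apply/subsetP => v; rewrite inE => /andP[].
(* Only O(d) arcs leave each vertex of X, so only O(d) vertices are beaten by
   more than a sixteenth of X. *)
pose Y := [set y in W :\: X | 16 * indeg_in X y <= #|X|].
have WY : #|W :\: Y| <= 49 * d.
  have mk := markov W (fun y => 16 * indeg_in X y) #|X|.
  rewrite -big_distrr /= -(double_count X W) in mk.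
  have out : \sum_(x in X) #|[set w in W | e x w]| <= #|X| * (3 * d).
    rewrite -sum_nat_const; apply: leq_sum => x /(subsetP XLow).
    by rewrite inE => /andP[].
  set Z := [set x in W | _] in mk.
  have Zd : #|Z| <= 48 * d.
    have X0 : 0 < #|X| by rewrite Xm muln_gt0.
    by rewrite -(leq_pmul2l X0); apply: leq_trans mk _; lia.
  have : W :\: Y \subset X :|: Z.
    apply/subsetP => v; rewrite !inE => /andP[+ vW]; rewrite vW andbT /= negb_and.
    by rewrite negbK -ltnNge => /orP[->//|/ltnW ->]; rewrite orbT.
  move=> /subset_leq_card le; apply: leq_trans le _.
  by apply: leq_trans (leq_card_setU _ _) _; lia.
have XL : #|X| * L.+2 <= b by rewrite Xm.
have WYd : #|W :\: Y| < 50 * d - 100 * b by lia.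
have [P [Ppath Pdisj]] := escape_paths XW XL WYd dW.
pose c := contracted e X P.
have nonout x : x \in X -> 16 * #|[set y in X | ~~ c x y]| <= 8 * f.
  move=> xX; have [_ ] := Ppath x xX; rewrite !inE => /andP[/andP[zX zW] zY].
  rewrite -Xm; apply: leq_trans zY; rewrite leq_mul2l /=; apply: subset_leq_card.
  apply/subsetP => y; rewrite !inE /c /contracted xX => /andP[yX]; rewrite yX /= => nzy.
  have zy : last x (P x) != y by apply: contraNneq zX => ->.
  by have := e_tour zW (subsetP XW y yX) zy; rewrite (negbTE nzy).
pose Q := [set v in X | 4 * #|[set x in X | ~~ c x v]| <= 8 * f].
have QX : Q \subset X by apply/subsetP => v; rewrite inE => /andP[].
have XQ : #|X :\: Q| <= 2 * f.
  have mk := markov X (fun v => 4 * #|[set x in X | ~~ c x v]|) (8 * f).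
  rewrite -big_distrr /= -(double_count X X) in mk.
  have out : 16 * \sum_(x in X) #|[set w in X | ~~ c x w]| <= #|X| * (8 * f).
    rewrite big_distrr /= -sum_nat_const; exact: leq_sum.
  set Z := [set x in X | _] in mk.
  have Zd : #|Z| <= 2 * f.
    have X0 : 0 < 8 * f by rewrite muln_gt0.
    rewrite -(leq_pmul2l X0); apply: leq_trans mk _; rewrite Xm in out; lia.
  apply: leq_trans Zd; apply: subset_leq_card; apply/subsetP => v.
  rewrite !inE => /andP[+ vX]; rewrite vX /= -ltnNge; exact: ltnW.
have spl := cardsID Q X; rewrite (setIidPr QX) in spl.
have [l lr lm] : exists2 l, size l = r & clique_model c l.
  apply: (@clique_model_dense V c Q (8 * 2 * h) f 2 _ 2 h) => //; try lia.
  - move=> F Ff u v; rewrite !inE => /and3P[uF uX _] /and3P[vF vX vQ].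
    have /subsetPn[w wX] : ~~ (X \subset [set y in X | ~~ c u y] :|: [set x in X | ~~ c x v] :|: F).
      apply/negP => /subset_leq_card le.
      have h1 := nonout u uX.
      have := leq_trans le (leq_card_setU _ _).
      have h2 : #|[set y in X | ~~ c u y] :|: [set x in X | ~~ c x v]| <=
         #|[set y in X | ~~ c u y]| + #|[set x in X | ~~ c x v]| by exact: leq_card_setU.
      lia.
    rewrite !inE wX /= !negb_or !negbK => /andP[/andP[uw wv] wF].
    exists [:: w; v]; split=> //; split=> //=; first by rewrite uw wv.
    by move=> x; rewrite !inE => /orP[]/eqP->.
  - move=> A AQ QA v vQ; have vX := subsetP QX v vQ.
    have splA := cardsID A Q; rewrite (setIidPr AQ) in splA.
    have : #|A :\: [set w | c v w]| <= #|[set y in X | ~~ c v y]|.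
      apply: subset_leq_card; apply/subsetP => w; rewrite !inE => /andP[-> wA].
      by rewrite (subsetP QX) ?(subsetP AQ).
    have := nonout v vX; lia.
exists (map (expand P) l); first by rewrite size_map.
by apply: clique_model_expand lm => // x /Ppath[].
Qed.
End Core.

(** * Large out-degree forces a strong minor *)

Lemma min_outdeg_le (V : finType) (T : digraph V) v :
  v \in verts T -> min_outdeg T <= outdeg T v.
Proof.
move=> vT; rewrite /min_outdeg; have := mem_index_enum v.
elim: (index_enum V) => // w s IH; rewrite inE big_cons => /predU1P[<-|/IH le].
  by rewrite vT geq_minl.
by case: ifP => // _; rewrite (leq_trans (geq_minr _ _)).
Qed.

Lemma arc_irr (V : finType) (T : digraph V) : irreflexive (arc T).
Proof. by move=> v; apply/negbTE; exact: arcs_loopless. Qed.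

(** The parameter h plays the role of sqrt (log_2 r). *)
Lemma strong_minor_of_min_outdeg : exists c, forall (V : finType) (T : digraph V) r h,
  is_tournament T -> 0 < r -> 0 < h -> r <= 2 ^ (h * h) ->
  c * r * h <= min_outdeg T -> has_strong_minor r T.
Proof.
(* Kept abstract so that the numeral is never unfolded. *)
have [L LE] : exists L, 50 * 500 <= L by exists (50 * 500).
exists (1000 * (1600 * L.+2)) => V T r h [T0 tour] r0 h0 rh big.
pose b := 1600 * L.+2 * r * h.
have b0 : 0 < b by rewrite !muln_gt0 r0 h0.
pose d := 500 * b; have dE : d = 500 * b by [].
have dL : 50 * d <= L * b by rewrite dE mulnA leq_mul2r LE orbT.
have {}big : 2 * d <= min_outdeg T.
  by apply: leq_trans big; rewrite dE /b -!mulnA; lia.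
(* The vertex set of T qualifies because the cap bounds the requirement by
   2d. *)
pose p (W : {set V}) := [&& W \subset verts T, W != set0 &
  [forall v in W, 50 * d + minn #|W| (50 * d) <= 50 * outdeg_in (arc T) W v]].
have pT : p (verts T).
  rewrite /p subxx T0; apply/forall_inP => v vT.
  have : outdeg T v <= outdeg_in (arc T) (verts T) v.
    apply: subset_leq_card; apply/subsetP => w; rewrite !inE => vw.
    by have := subsetP (arcs_verts T) _ vw; rewrite !inE vw => /andP[_ ->].
  have := min_outdeg_le vT; lia.
have [W /minsetP[/and3P[WT W0 /forall_inP Wdeg] Wm] _] := minset_exists pT.
have Wmin (R : {set V}) : R \proper W -> R != set0 ->
    exists2 v, v \in R & 50 * outdeg_in (arc T) R v < 50 * d + minn #|R| (50 * d).
  move=> RW R0; have nR : ~~ p R.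
    by apply/negP => pR; move: (RW); rewrite (Wm R pR (proper_sub RW)) properxx.
  have RT := subset_trans (proper_sub RW) WT.
  move: nR; rewrite /p RT R0 negb_forall_in => /exists_inP[v vR]; rewrite -ltnNge.
  by exists v.
have eT : {in W &, forall u v, u != v -> arc T u v (+) arc T v u}.
  by move=> u v uW vW; apply: tour; exact: (subsetP WT).
have [l lr lm] : exists2 l, size l = r & clique_model (arc T) l.
  have [Wd|dW] := leqP #|W| (50 * d).
    apply: (dense_model W0 (@arc_irr _ T) eT Wdeg Wmin dL dE Wd b0 h0 rh).
    rewrite /b -!mulnA; nia.
  apply: (sparse_model W0 eT Wdeg Wmin dL dE (ltnW dW) r0 h0 rh).
  rewrite /b; nia.
rewrite -lr; apply: has_strong_minor_model lm.
by rewrite -size_eq0 lr -lt0n.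
Qed.

(** * Tournaments from independent coins *)

Lemma leq_min_outdeg (V : finType) (T : digraph V) m : verts T != set0 ->
  {in verts T, forall v, m <= outdeg T v} -> m <= min_outdeg T.
Proof.
move=> /set0Pn[v vT] deg; rewrite /min_outdeg; elim/big_ind: _ => [|x y mx my|w]; last exact: deg.
  by apply: leq_trans (deg v vT) _; exact: max_card.
by rewrite leq_min mx.
Qed.

(** The exponential moment method: the sum over all g of 2 to the number of
    agreements with x on K factorizes over the coordinates, with factor 2 + 1 on
    K and 2 elsewhere. *)
Lemma chernoff (I : finType) (K : {set I}) (x : I -> bool) s :
  #|[set g : {ffun I -> bool} | s <= #|[set c in K | g c == x c]|]| * 2 ^ (s + #|K|)
    <= 3 ^ #|K| * 2 ^ #|I|.
Proof.
pose w c (y : bool) := if (c \in K) && (y == x c) then 2 else 1.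
have total : (\sum_(g : {ffun I -> bool}) \prod_c w c (g c)) * 2 ^ #|K| = 3 ^ #|K| * 2 ^ #|I|.
  rewrite -(bigA_distr_bigA w).
  have -> : \prod_c (\sum_y w c y) = 3 ^ #|K| * 2 ^ (#|I| - #|K|).
    rewrite (bigID (mem K)) /=; congr (_ * _).
      rewrite -prod_nat_const; apply: eq_bigr => c cK.
      by rewrite big_bool /w cK; case: (x c).
    rewrite (_ : #|I| - #|K| = #|~: K|); last by rewrite [RHS]cardsCs setCK.
    rewrite -prod_nat_const; apply: eq_big => [c|c cK]; first by rewrite inE.
    by rewrite big_bool /w (negbTE cK).
  by rewrite -mulnA -expnD subnK ?max_card.
have prodE (g : {ffun I -> bool}) : \prod_c w c (g c) = 2 ^ #|[set c in K | g c == x c]|.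
  rewrite -prod_nat_const [RHS]big_mkcond /=; apply: eq_bigr => c _.
  by rewrite inE /w.
rewrite -total expnD mulnA leq_mul2r; apply/orP; right.
have := markov [set: {ffun I -> bool}] (fun g => \prod_c w c (g c)) (2 ^ s).
rewrite mulnC; under [leqRHS]eq_bigl do rewrite inE.
move/(leq_trans _); apply; rewrite leq_mul2r; apply/orP; right.
apply: subset_leq_card; apply/subsetP => g; rewrite !inE prodE => le.
by rewrite leq_exp2l.
Qed.

Section RandomTournament.
Variable n : nat.
Notation coins := {ffun 'I_n * 'I_n -> bool}.
Implicit Types (g : coins) (u v w : 'I_n).

(** Only the coins at increasing pairs matter; the other coins multiply every
    count by the same factor. *)
Definition beats g u v := if u < v then g (u, v) else if v < u then ~~ g (v, u) else false.

Lemma beats_tour g u v : u != v -> beats g u v (+) beats g v u.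
Proof.
rewrite -val_eqE /beats /=; case: ltngtP => //= _ _; first by case: (g _).
by case: (g _).
Qed.

Lemma beats_irr g : irreflexive (beats g).
Proof. by move=> u; rewrite /beats ltnn. Qed.

Lemma coin_arcs_verts g : [set p | beats g p.1 p.2] \subset setX [set: 'I_n] [set: 'I_n].
Proof. by apply/subsetP => p; rewrite !inE. Qed.

Lemma coin_arcs_loopless g v : (v, v) \notin [set p | beats g p.1 p.2].
Proof. by rewrite inE beats_irr. Qed.

Definition coin_tournament g : digraph 'I_n :=
  Digraph (coin_arcs_verts g) (coin_arcs_loopless g).

Lemma arc_coin g : arc (coin_tournament g) =2 beats g.
Proof. by move=> u v; rewrite /arc inE. Qed.

Lemma coin_tournamentP g : 0 < n -> is_tournament (coin_tournament g).
Proof.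
move=> n0; split; first by apply/set0Pn; exists (Ordinal n0); rewrite inE.
by move=> u v _ _ uv; rewrite !arc_coin beats_tour.
Qed.

(** The coin that decides the arc between v and w. *)
Definition coin_of v w := if w < v then (w, v) else (v, w).

(** A vertex with out-degree at most a among 10a others has at least 9a
    in-neighbours, and 3^(10a) / 2^(19a) <= 8^(-a) because 3^5 <= 2^8. *)
Lemma few_low_outdeg a v : n = 10 * a + 1 ->
  #|[set g | outdeg (coin_tournament g) v <= a]| * 8 ^ a <= 2 ^ #|{: 'I_n * 'I_n}|.
Proof.
move=> nE; pose K := [set coin_of v w | w in [set~ v]].
have inj : {in [set~ v] &, injective (coin_of v)}.
  move=> u w; rewrite !inE /coin_of => uv wv.
  by case: ltnP => _; case: ltnP => _ [] // ? ?; subst; rewrite ?eqxx in uv wv *.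
have cK : #|K| = 10 * a by rewrite card_in_imset // cardsC1 card_ord; lia.
have := chernoff K (fun c => c.2 == v) (9 * a); rewrite cK => ch.
have le : #|[set g | outdeg (coin_tournament g) v <= a]| <=
   #|[set g : coins | 9 * a <= #|[set c in K | g c == (c.2 == v)]|]|.
  apply: subset_leq_card; apply/subsetP => g; rewrite !inE => low.
  have sub : [set coin_of v w | w in [set w | beats g w v]] \subset [set c in K | g c == (c.2 == v)].
    apply/subsetP => c /imsetP[w]; rewrite inE => wv ->; rewrite inE.
    have w_v : w != v by apply: contraTneq wv => ->; rewrite beats_irr.
    apply/andP; split; first by apply: imset_f; rewrite !inE.
    move: wv; rewrite /beats /coin_of; case: (ltngtP w v) => //= wv; first by move=> ->; rewrite eqxx.
    by rewrite (negbTE w_v) eqbF_neg.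
  apply: leq_trans (subset_leq_card sub).
  rewrite card_in_imset; last first.
    by move=> u w; rewrite !inE => uv wv; apply: inj; rewrite !inE;
       [apply: contraTneq uv|apply: contraTneq wv] => ->; rewrite beats_irr.
  have : #|[set~ v]| <= #|[set w | beats g w v]| + outdeg (coin_tournament g) v.
    apply: leq_trans (leq_card_setU _ _); apply: subset_leq_card; apply/subsetP => w.
    by rewrite !inE arc_coin => /(beats_tour g); case: (beats g w v).
  rewrite cardsC1 card_ord; lia.
have p2 : 0 < 2 ^ (16 * a) by rewrite expn_gt0.
rewrite -(leq_pmul2l p2); apply: leq_trans (_ : 3 ^ (10 * a) * 2 ^ #|{: 'I_n * 'I_n}| <= _).
  apply: leq_trans ch; rewrite mulnCA; apply: leq_mul => //.
  by rewrite (_ : 8 = 2 ^ 3) // -expnM -expnD leq_exp2l //; lia.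
rewrite leq_mul2r; apply/orP; right.
rewrite (_ : 10 * a = 5 * (2 * a)); last by lia.
rewrite (_ : 16 * a = 8 * (2 * a)); last by lia.
by rewrite [3 ^ _]expnM [2 ^ _]expnM leq_exp_base.
Qed.

Variable r : nat.
Notation coloring := {ffun 'I_n -> option 'I_r}.
Implicit Types (phi : coloring) (i j : 'I_r) (p : 'I_r * 'I_r).

Definition cls phi i := [set v | phi v == Some i].

Definition joins g phi p := arcs_to (beats g) (cls phi p.1) (cls phi p.2).

(** The coins that decide the arcs between the two classes of p. *)
Definition block phi p := [set c : 'I_n * 'I_n | (c.1 < c.2) &&
  ((phi c.1 == Some p.1) && (phi c.2 == Some p.2) ||
   (phi c.1 == Some p.2) && (phi c.2 == Some p.1))].

(** All arcs between the two classes are turned to go from the second to the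
    first. *)
Definition severed phi p g : coins :=
  [ffun c => if c \in block phi p then phi c.1 == Some p.2 else g c].

Lemma severed_not_joins phi p g : p.1 != p.2 -> ~~ joins (severed phi p g) phi p.
Proof.
move=> p12; apply/exists_inP => -[u]; rewrite inE => up /exists_inP[v]; rewrite inE => vp.
have ne : (Some p.1 == Some p.2) = false by apply/negbTE.
have ne' : (Some p.2 == Some p.1) = false by rewrite eq_sym.
rewrite /beats !ffunE !inE /= (eqP up) (eqP vp) !eqxx ne ne' /=.
by case: (ltngtP u v) => //=; rewrite ?eqxx.
Qed.

(** Distinct pairs of classes are governed by disjoint sets of coins. *)
Lemma severed_joins phi p p' g : p.1 < p.2 -> p'.1 < p'.2 -> p' != p ->
  joins (severed phi p g) phi p' = joins g phi p'.
Proof.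
move=> lt lt' pp'; apply: eq_existsb => u; rewrite inE; case: eqP => //= up.
apply: eq_existsb => v; rewrite inE; case: eqP => //= vp.
have ne1 : (p'.1 == p.1) && (p'.2 == p.2) = false.
  by apply: contraNF pp' => /andP[/eqP e1 /eqP e2]; rewrite [p']surjective_pairing e1 e2 -surjective_pairing.
have ne2 : (p'.1 == p.2) && (p'.2 == p.1) = false.
  by apply: contraTF lt' => /andP[/eqP-> /eqP->]; rewrite -leqNgt ltnW.
have SE (i j : 'I_r) : (Some i == Some j) = (i == j) by [].
rewrite /beats !ffunE !inE /= up vp !SE.
by rewrite [(p'.2 == _) && (p'.1 == _)]andbC [(p'.2 == p.2) && _]andbC ne1 ne2 !andbF.
Qed.

Lemma card_block phi p : #|block phi p| <= 2 * (#|cls phi p.1| * #|cls phi p.2|).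
Proof.
rewrite mul2n -addnn -{1}cardsX mulnC -cardsX.
apply: leq_trans (leq_card_setU _ _); apply: subset_leq_card.
by apply/subsetP => c; rewrite !inE => /andP[_].
Qed.

Definition joining phi (s : seq ('I_r * 'I_r)) := [set g : coins | all (joins g phi) s].

(** Severing the classes of p keeps all pairs of s joined and forgets at most k
    coins, so among the assignments that join all pairs of s, at least a 2^(-k)
    fraction fails to join p. *)
Lemma joining_step phi p s k : p.1 < p.2 -> all (fun p' => p'.1 < p'.2) s -> p \notin s ->
    #|block phi p| <= k ->
  #|joining phi (p :: s)| * 2 ^ k <= (2 ^ k - 1) * #|joining phi s|.
Proof.
move=> lt /allP lts ps bk.
pose cut := joining phi s :\: joining phi (p :: s).
have sub : joining phi (p :: s) \subset joining phi s.
  by apply/subsetP => g; rewrite !inE /= => /andP[].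
have spl := cardsID (joining phi (p :: s)) (joining phi s).
rewrite (setIidPr sub) -/cut in spl.
suff : #|joining phi s| <= #|cut| * 2 ^ k.
  move: (2 ^ k) => q le; rewrite mulnBl mul1n.
  by rewrite -[X in q * X]spl mulnDr [#|_| * q]mulnC -addnBA ?leq_addr // mulnC.
pose f g := (severed phi p g, [set c in block phi p | g c]).
have finj : injective f.
  move=> g g' [/ffunP sv /setP on]; apply/ffunP => c.
  have := sv c; have := on c; rewrite !ffunE !inE; case: ifP => //= cb.
rewrite -(card_imset _ finj).
apply: leq_trans (_ : #|setX cut (powerset (block phi p))| <= _).
  apply: subset_leq_card; apply/subsetP => _ /imsetP[g gs ->]; rewrite !inE /=.
  have sg : all (joins (severed phi p g) phi) s.
    move: gs; rewrite inE => /allP gs; apply/allP => p' p's.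
    by rewrite (severed_joins _ _ lt (lts _ p's)) ?gs //; apply: contraNneq ps => <-.
  rewrite sg (negbTE (severed_not_joins _ _ _)) /=; last by rewrite -val_eqE neq_ltn lt.
  by apply/subsetP => c; rewrite !inE => /andP[].
by rewrite cardsX card_powerset leq_mul2l leq_exp2l // bk orbT.
Qed.

(** In effect the pairs of s are joined independently, each with probability at
    most 1 - 2^(-k). *)
Lemma joining_bound phi s k : uniq s ->
    all (fun p' => (p'.1 < p'.2) && (#|block phi p'| <= k)) s ->
  #|joining phi s| * (2 ^ k) ^ size s <= (2 ^ k - 1) ^ size s * 2 ^ #|{: 'I_n * 'I_n}|.
Proof.
elim: s => [_ _|p s IH /= /andP[ps us] /andP[/andP[lt bk] sP]].
  rewrite !expn0 muln1 mul1n -card_bool -card_ffun; exact: max_card.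
have lts : all (fun p' => p'.1 < p'.2) s by apply: sub_all sP => p' /andP[].
have := joining_step lt lts ps bk; have := IH us sP.
rewrite !expnS => h1 h2.
rewrite mulnA; apply: leq_trans (leq_mul h2 (leqnn _)) _.
by rewrite -!mulnA leq_mul2l h1 orbT.
Qed.

(** At least half of the r classes have at most tau vertices, at least
    twice the average size. *)
Lemma small_pairs phi tau : 4 <= r -> 2 * n <= tau * r ->
  exists s, [/\ uniq s, r * r <= 16 * size s &
    all (fun p => (p.1 < p.2) && (#|block phi p| <= 2 * (tau * tau))) s].
Proof.
move=> r4 nr; pose J := [set i | #|cls phi i| <= tau].
have Jr : r <= 2 * #|J|.
  have mk := markov [set: 'I_r] (fun i => #|[set v in [set: 'I_n] | phi v == Some i]|) tau.+1.
  rewrite (double_count _ _ (fun i v => phi v == Some i)) in mk.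
  have one : \sum_(v in [set: 'I_n]) #|[set i in [set: 'I_r] | phi v == Some i]| <= n.
    rewrite -[n in leqRHS]card_ord -cardsT -sum1_card; apply: leq_sum => v _.
    case: (phi v) => [i|]; last by rewrite (_ : [set _ in _ | _] = set0) ?cards0 //; apply/setP => i; rewrite !inE.
    by rewrite (_ : [set _ in _ | _] = [set i]) ?cards1 //; apply/setP => j; rewrite !inE eq_sym.
  have := cardsC J; rewrite card_ord.
  have : #|~: J| <= #|[set i in [set: 'I_r] | tau < #|[set v in [set: 'I_n] | phi v == Some i]|]|.
    apply: subset_leq_card; apply/subsetP => i; rewrite !inE -ltnNge /=.
    by rewrite (_ : cls phi i = [set v in [set: 'I_n] | phi v == Some i]) //; apply/setP => v; rewrite !inE.
  have := leq_trans mk one; set B := #|_| => Bn BJ JC.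
  suff : 2 * B <= r by lia.
  by rewrite leqNgt; apply/negP => rB; nia.
pose S := [set p : 'I_r * 'I_r | [&& p.1 \in J, p.2 \in J & p.1 < p.2]].
have cS : 2 * #|S| = #|J| * (#|J| - 1).
  rewrite -(@sum_outdeg_in _ (fun i j : 'I_r => i < j) [set: 'I_r]) //; first last.
  - by move=> i j _ _; rewrite -val_eqE /=; case: ltngtP.
  - by move=> i; rewrite /= ltnn.
  congr (2 * _); rewrite -sum1dep_card (eq_bigr (fun i => \sum_(j in J | i < j) 1)); last first.
    by move=> i _; rewrite sum1dep_card.
  by rewrite pair_big_dep; apply: eq_bigl => p; rewrite andbA.
exists (enum S); split; rewrite ?enum_uniq //.
  rewrite -cardE; nia.
apply/allP => p; rewrite mem_enum !inE => /and3P[p1 p2 ->] /=.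
by apply: leq_trans (card_block _ _) _; rewrite leq_mul2l leq_mul.
Qed.

(** The first r branch sets become the classes; the other vertices stay
    uncolored. *)
Lemma coloring_of_minor g s : has_strong_minor s (coin_tournament g) -> r <= s ->
  exists phi, forall p, p.1 != p.2 -> joins g phi p.
Proof.
move=> [D [_ /andP[_ DT] [P [/and3P[_ /trivIsetP tP _] cP _ arcsP]]]] rs.
pose psi (i : 'I_r) := nth set0 (enum P) i.
have iP (i : 'I_r) : i < size (enum P) by rewrite -cardE cP (leq_trans (ltn_ord i)).
have psiP i : psi i \in P by rewrite -mem_enum mem_nth.
have psi_inj i j : i != j -> psi i != psi j.
  by move=> ij; rewrite /psi nth_uniq ?enum_uniq.
pose phi : coloring := [ffun v => [pick i | v \in psi i]].
have cls_psi i : cls phi i = psi i.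
  apply/setP => v; rewrite inE ffunE; case: pickP => [j vj|none]; last by rewrite none.
  have [ji|ji] := eqVneq j i; first by rewrite -ji vj eqxx.
  have -> : (Some j == Some i) = (j == i) by [].
  rewrite (negbTE ji); apply/esym/negbTE/negP => vi.
  by have /pred0P/(_ v) := tP _ _ (psiP j) (psiP i) (psi_inj _ _ ji); rewrite /= vj vi.
exists phi => p p12; rewrite /joins !cls_psi.
have [u [v [uA vB uv]]] := arcsP _ _ (psiP p.1) (psiP p.2) (psi_inj _ _ p12).
apply/exists_inP; exists u => //; apply/exists_inP; exists v => //.
by rewrite -arc_coin; exact: (subsetP DT).
Qed.

(** A union bound over all colorings. For a fixed coloring, the r^2 / 16 pairs of
    small classes come in w groups of q = 2^(2 tau^2), and each group is joined
    with probability at most (1 - 1/q)^q <= 1/2. *)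
Lemma few_minors tau (w : nat) : 4 <= r -> 2 * n <= tau * r ->
    16 * (2 ^ (2 * (tau * tau)) * w) <= r * r ->
  #|[set g | [exists phi : coloring, [forall p, (p.1 != p.2) ==> joins g phi p]]]| * 2 ^ w
    <= r.+1 ^ n * 2 ^ #|{: 'I_n * 'I_n}|.
Proof.
move=> r4 nr wr; set q := 2 ^ _ in wr.
have q0 : 0 < q by rewrite expn_gt0.
have one phi : #|[set g | [forall p, (p.1 != p.2) ==> joins g phi p]]| * 2 ^ w
    <= 2 ^ #|{: 'I_n * 'I_n}|.
  have [s [us rs sP]] := small_pairs phi r4 nr.
  have ws : q * w <= size s by lia.
  have := joining_bound us sP; rewrite -/q => bound.
  have qs : 0 < q ^ size s by rewrite expn_gt0 q0.
  rewrite -(leq_pmul2r qs).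
  have sub : #|[set g | [forall p, (p.1 != p.2) ==> joins g phi p]]| <= #|joining phi s|.
    apply: subset_leq_card; apply/subsetP => g; rewrite !inE => /forallP jP.
    apply/allP => p /(allP sP) /andP[lt _]; apply: (implyP (jP p)).
    by rewrite -val_eqE neq_ltn lt.
  apply: leq_trans (leq_mul (leq_mul sub (leqnn _)) (leqnn _)) _.
  rewrite mulnAC; apply: leq_trans (leq_mul bound (leqnn _)) _.
  rewrite mulnAC mulnC leq_mul2l; apply/orP; right.
  rewrite -(subnK ws) !expnD -mulnA; apply: leq_mul; first by apply: leq_exp_base; lia.
  rewrite [(q - 1) ^ _]expnM [q ^ _]expnM -expnMn; apply: leq_exp_base.
  by rewrite mulnC; exact: expn_pred_halves.
have -> : [set g | [exists phi : coloring, [forall p, (p.1 != p.2) ==> joins g phi p]]] =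
    \bigcup_(phi : coloring) [set g | [forall p, (p.1 != p.2) ==> joins g phi p]].
  apply/setP => g; rewrite inE; apply/existsP/bigcupP => [[phi ph]|[phi _]].
    by exists phi; rewrite ?inE.
  by rewrite inE; exists phi.
have -> : r.+1 ^ n = #|{: coloring}| by rewrite card_ffun card_option !card_ord.
apply: leq_trans (_ : (\sum_(phi : coloring)
   #|[set g | [forall p, (p.1 != p.2) ==> joins g phi p]]|) * 2 ^ w <= _).
  by rewrite leq_mul2r card_bigcup_leq orbT.
by rewrite big_distrl /= -sum_nat_const; apply: leq_sum => phi _; exact: one.
Qed.
End RandomTournament.

(** * A tournament without a strong minor *)

Lemma cubic_lt_exp k : 32 * k.+2 * (k.+3 * k.+3) + 16 <= 64 ^ k.+2.
Proof. by elim: k => [|k IH]; rewrite expnS; [lia|nia]. Qed.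

Lemma linear_lt_exp k : 40 * k.+3 + 4 <= 8 ^ k.+3.
Proof. by elim: k => [|k IH]; rewrite expnS; lia. Qed.

Lemma few_sparse_coins n a : n = 10 * a + 1 -> 3 <= a ->
  #|[set g | [exists v, outdeg (@coin_tournament n g) v <= a]]| * 4
    <= 2 ^ #|{: 'I_n * 'I_n}|.
Proof.
move=> nE a3.
have n0 : 0 < n by lia.
have n4 : 4 * n <= 8 ^ a.
  by case: a a3 nE => [|[|[|a]]] // _ ->; apply: leq_trans (linear_lt_exp a); lia.
rewrite -(leq_pmul2r n0) -mulnA [leqRHS]mulnC; apply: leq_trans (leq_mul (leqnn _) n4) _.
have -> : [set g | [exists v, outdeg (@coin_tournament n g) v <= a]] =
    \bigcup_v [set g | outdeg (@coin_tournament n g) v <= a].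
  apply/setP => g; rewrite inE; apply/existsP/bigcupP => [[v vh]|[v _]].
    by exists v; rewrite ?inE.
  by rewrite inE; exists v.
apply: leq_trans (_ : (\sum_v #|[set g | outdeg (@coin_tournament n g) v <= a]|) * 8 ^ a <= _).
  by rewrite leq_mul2r card_bigcup_leq orbT.
rewrite big_distrl /= -[X in _ <= X * _]card_ord -sum_nat_const.
by apply: leq_sum => v _; exact: few_low_outdeg.
Qed.

(** With n about tau r / 4 vertices, the number of colorings is
    2^(O(tau^3 r)), while a fixed coloring gives a minor with probability at most
    2^(-r^2 / (16 q)), where q = 2^(2 tau^2) <= sqrt r. *)
Lemma tournament_without_minor r tau :
    3 <= tau -> 2 ^ (4 * (tau * tau)) <= r -> r < 2 ^ (4 * (tau.+1 * tau.+1)) ->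
  exists (V : finType) (T : digraph V),
    [/\ is_tournament T, tau * r <= 80 * min_outdeg T & sm T < r].
Proof.
move=> t3 rlo rhi.
pose a := (tau * r) %/ 40; pose n := 10 * a + 1.
have r64 : 64 <= r.
  apply: leq_trans rlo; rewrite (_ : 64 = 2 ^ 6) // leq_exp2l //; nia.
have tr : 192 <= tau * r by nia.
have a3 : 3 <= a by rewrite /a; lia.
have n2 : 2 * n <= tau * r by rewrite /n /a; lia.
have N0 : 0 < 2 ^ #|{: 'I_n * 'I_n}| by rewrite expn_gt0.
(* Kept abstract so that the power is never computed. *)
have [q qE] : exists q, q = 2 ^ (2 * (tau * tau)) by eexists.
have qr : q * q <= r by rewrite qE -expnD; apply: leq_trans rlo; rewrite leq_exp2l //; lia.
pose l := 4 * (tau.+1 * tau.+1).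
have lq : 8 * l * tau + 16 <= q.
  apply: leq_trans (_ : 64 ^ tau <= _).
    case: tau t3 @l {rlo rhi a n tr a3 n2 N0 q qE qr} => [|[|k]] // _ /=.
    apply: leq_trans (cubic_lt_exp k); nia.
  by rewrite qE (_ : 64 = 2 ^ 6) // -expnM leq_exp2l //; nia.
have wr : 16 * (q * (l * n + 1)) <= r * r.
  have h1 : 16 * (l * n + 1) <= r * (8 * l * tau + 16) by nia.
  have h2 : 16 * (l * n + 1) <= r * q by apply: leq_trans h1 _; rewrite leq_mul2l lq orbT.
  rewrite mulnCA; apply: leq_trans (leq_mul (leqnn q) h2) _.
  by rewrite mulnCA leq_mul2l qr orbT.
have r4 : 4 <= r by lia.
rewrite qE in wr.
have minors := @few_minors n r tau (l * n + 1) r4 n2 wr.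
have {}minors : #|[set g | [exists phi : {ffun 'I_n -> option 'I_r},
    [forall p, (p.1 != p.2) ==> joins g phi p]]]| * 2 <= 2 ^ #|{: 'I_n * 'I_n}|.
  have x0 : 0 < 2 ^ (l * n) by rewrite expn_gt0.
  rewrite -(leq_pmul2r x0) -mulnA -expnS -[(l * n).+1]addn1.
  apply: leq_trans minors _; rewrite mulnC leq_mul2l expnM.
  by apply/orP; right; apply: leq_exp_base.
have degs := few_sparse_coins (erefl n) a3.
have total : #|{ffun 'I_n * 'I_n -> bool}| = 2 ^ #|{: 'I_n * 'I_n}|.
  by rewrite card_ffun card_bool.
set M := [set g | _] in minors; set S := [set g | _] in degs.
have /subsetPn[g _] : ~~ ([set: {ffun 'I_n * 'I_n -> bool}] \subset M :|: S).
  apply/negP => /subset_leq_card; rewrite cardsT total => le.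
  have := leq_trans le (leq_card_setU _ _).
  move: minors degs N0; rewrite -/n; move: (2 ^ _) #|M| #|S| => x y z; lia.
rewrite !inE negb_or => /andP[noM noS].
have n0 : 0 < n by rewrite /n addn1.
have gT := coin_tournamentP g n0.
exists 'I_n, (coin_tournament g); split=> //.
  apply: leq_trans (_ : 80 * a <= _); first by rewrite /a; lia.
  rewrite leq_mul2l; apply/orP; right; apply: leq_min_outdeg; first by case: gT.
  move=> v _; move: noS; rewrite negb_exists => /forallP/(_ v).
  by rewrite -ltnNge; exact: ltnW.
rewrite ltnNge; apply/negP => rs; move/negP: noM; apply.
have [phi phiP] := coloring_of_minor (has_strong_minor_sm (proj1 gT)) rs.
by apply/existsP; exists phi; apply/forallP => p; apply/implyP; exact: phiP.
Qed.

(** * Logarithms and the theorem *)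

Import Order.TTheory GRing.Theory Num.Theory.
Local Open Scope ring_scope.

Section Logs.
Variable R : realType.

Lemma ln2_gt0 : 0 < ln (2 : R).
Proof. by apply: ln_gt0; rewrite ltr1n. Qed.

Lemma ln2_le1 : ln (2 : R) <= 1.
Proof.
rewrite (_ : 2 = 1 + 1 :> R) //; apply: le_ln1Dx.
exact: lt_trans (ltrN10 _) ltr01.
Qed.

Lemma ln_exp2n k : ln ((2 ^ k)%N%:R : R) = k%:R * ln 2.
Proof. by rewrite natrX lnXn ?mulr_natl // ltr0n. Qed.

(** The least h with r <= 2^(h^2) has 2^((h - 1)^2) < r, and h <= 2 (h - 1) when
    h is at least 2. *)
Lemma square_exponent r : (1 < r)%N ->
  exists h, [/\ (0 < h)%N, (r <= 2 ^ (h * h))%N &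
    h%:R * Num.sqrt (ln (2 : R)) <= 2 * Num.sqrt (ln (r%:R : R))].
Proof.
move=> r1; have ex : exists h, (r <= 2 ^ (h * h))%N.
  exists r; apply: leq_trans (ltnW (ltn_expl r (leqnn 2))) _.
  by rewrite leq_exp2l // leq_pmulr // ltnW.
case: (ex_minnP ex) => h rh hmin.
have h0 : (0 < h)%N by case: h rh {hmin} => //; rewrite leqNgt r1.
have r2 : ln (2 : R) <= ln r%:R by rewrite ler_ln ?posrE ?ltr0n ?ler_nat // ltnW.
have lnr : 0 <= ln (r%:R : R) by apply: le_trans r2; rewrite ltW ?ln2_gt0.
exists h; split=> //.
have sq : (h * h)%N%:R * ln (2 : R) <= 4 * ln r%:R.
  have [h1|h1] := leqP h 1.
    have -> : h = 1%N by apply/eqP; rewrite eqn_leq h1.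
    by rewrite mul1r; apply: le_trans r2 _; rewrite ler_peMl // ler1n.
  have lt : (2 ^ (h.-1 * h.-1) < r)%N.
    by rewrite ltnNge; apply/negP => /hmin; lia.
  have le1 : (h.-1 * h.-1)%N%:R * ln (2 : R) <= ln r%:R.
    by rewrite -ln_exp2n ler_ln ?posrE ?ltr0n ?expn_gt0 ?ler_nat ?(ltnW lt) // ltnW.
  apply: le_trans (_ : 4 * ((h.-1 * h.-1)%N%:R * ln (2 : R)) <= _); last first.
    by rewrite ler_pM2l // ltr0n.
  rewrite mulrA ler_pM2r ?ln2_gt0 // -natrM ler_nat; nia.
rewrite -[X in X * _]ger0_norm ?ler0n // -sqrtr_sqr.
rewrite -[X in _ <= X * _]ger0_norm ?ler0n // -[X in _ <= X * _]sqrtr_sqr.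
rewrite -!sqrtrM ?sqr_ge0 // ler_sqrt; last by rewrite mulr_ge0 // sqr_ge0.
by move: sq; rewrite -!natrX mulnn.
Qed.

Lemma quartic_exponent k r : (0 < k)%N -> (2 ^ (4 * (k * k)) <= r)%N ->
  exists tau, [/\ (k <= tau)%N, (2 ^ (4 * (tau * tau)) <= r)%N,
    (r < 2 ^ (4 * (tau.+1 * tau.+1)))%N &
    Num.sqrt (ln (r%:R : R)) <= 4 * tau%:R].
Proof.
move=> k0 r0; have r_gt0 : (0 < r)%N by apply: leq_trans r0; rewrite expn_gt0.
have bound j : (2 ^ (4 * (j * j)) <= r)%N -> (j <= r)%N.
  move=> le; apply: leq_trans le; apply: leq_trans (ltnW (ltn_expl j (leqnn 2))) _.
  by rewrite leq_exp2l //; nia.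
case: (ex_maxnP (ex_intro _ k r0) bound) => tau le tmax.
have kt := tmax k r0.
have lt : (r < 2 ^ (4 * (tau.+1 * tau.+1)))%N.
  by rewrite ltnNge; apply/negP => /tmax; rewrite ltnn.
exists tau; split=> //.
have -> : 4 * tau%:R = Num.sqrt ((4 * tau%:R) ^+ 2) :> R.
  by rewrite sqrtr_sqr ger0_norm // mulr_ge0 // ler0n.
rewrite ler_sqrt ?sqr_ge0 //.
apply: le_trans (_ : ln ((2 ^ (4 * (tau.+1 * tau.+1)))%N%:R) <= _).
  by rewrite ler_ln ?posrE ?ltr0n ?expn_gt0 // ler_nat ltnW.
rewrite ln_exp2n; apply: le_trans (ler_piMr (ler0n _ _) ln2_le1) _.
rewrite -natrM -natrX ler_nat; nia.
Qed.
End Logs.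

Theorem theorem1p3 (R : realType) :
  (exists C : R, 0 < C /\
     forall r : nat, (0 < r)%N ->
     forall (V : finType) (T : digraph V), is_tournament T ->
       C * r%:R * Num.sqrt (ln (r%:R : R)) <= (min_outdeg T)%:R ->
       (r <= sm T)%N) /\
  (exists c : R, 0 < c /\
     exists r0 : nat, forall r : nat, (r0 <= r)%N ->
     exists (V : finType) (T : digraph V), [/\ is_tournament T,
       c * r%:R * Num.sqrt (ln (r%:R : R)) <= (min_outdeg T)%:R &
       (sm T < r)%N]).
Proof.
split.
- have [c cP] := strong_minor_of_min_outdeg.
  pose s2 := Num.sqrt (ln (2 : R)).
  have s0 : 0 < s2 by rewrite sqrtr_gt0 ln2_gt0.
  exists (c%:R * 2 / s2 + 1); split.
    by rewrite ltr_wpDl // !mulr_ge0 ?ler0n // invr_ge0 ltW.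
  move=> r r0 V T tourT deg; apply: sm_max.
  have [r1|r1] := leqP r 1.
    have -> : r = 1%N by apply/eqP; rewrite eqn_leq r1.
    by apply: has_strong_minor1; case: tourT.
  have [h [h0 rh hr]] := square_exponent R r1.
  apply: (cP V T r h) => //; rewrite -(ler_nat R); apply: le_trans deg.
  set x := Num.sqrt (ln r%:R) in hr *.
  have hx : h%:R <= 2 * x / s2 by rewrite ler_pdivlMr.
  rewrite !natrM; apply: le_trans (ler_wpM2l _ hx) _; first by rewrite mulr_ge0.
  have -> : c%:R * r%:R * (2 * x / s2) = c%:R * 2 / s2 * r%:R * x by ring.
  by rewrite !ler_wpM2r ?sqrtr_ge0 ?ler0n // lerDl ler01.
- exists (320%:R^-1); split; first by rewrite invr_gt0 ltr0n.
  exists (2 ^ (4 * (3 * 3)))%N => r r0.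
  have [tau [t3 lo hi sr]] := quartic_exponent R (isT : 0 < 3)%N r0.
  have [V [T [tourT deg smT]]] := tournament_without_minor t3 lo hi.
  exists V, T; split=> //.
  rewrite -mulrA ler_pdivrMl ?ltr0n //.
  apply: le_trans (ler_wpM2l (ler0n _ r) sr) _.
  rewrite -!natrM ler_nat; lia.
Qed.
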